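(* Let $X$ and $Y$ be completely regular spaces. Suppose that measures $\mu_n\in\mathcal{P}_r(X)$ converge weakly to a measure $\mu\in\mathcal{P}_r(X)$, measures $\nu_n\in\mathcal{P}_r(Y)$ converge weakly to a measure $\nu\in\mathcal{P}_r(Y)$, both sequences are uniformly tight (which holds automatically if both spaces are sequentially Prohorov), and continuous functions $h_n\colon X\times Y\to[0,+\infty)$ converge to a function $h\colon X\times Y\to[0,+\infty)$ uniformly on compact sets. Suppose also that there are nonnegative Borel functions $a_n\in L^1(\mu_n)$ and $b_n\in L^1(\nu_n)$ such that $$h_n(x,y)\le a_n(x)+b_n(y),\qquad \lim_{R\to+\infty}\sup_n\Bigl(\int_{\{a_n\ge R\}}a_n\,d\mu_n+\int_{\{b_n\ge R\}}b_n\,d\nu_n\Bigr)=0.$$ Then $$K_h(\mu,\nu)=\lim_{n\to\infty}K_{h_n}(\mu_n,\nu_n).$$ In particular, this is true if (instead of the limit condition on $a_n,b_n$) one has $\sup_n(\|a_n\|_{L^p(\mu_n)}+\|b_n\|_{L^p(\nu_n)})<\infty$ for some $p>1$.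
   Context: Completely regular spaces are Hausdorff. $\mathcal{P}_r(Z)$ is the set of Radon probability measures on $Z$: Borel probability measures $\mu$ such that for every Borel set $B$ and $\varepsilon>0$ there is a compact set $K\subset B$ with $\mu(B\setminus K)<\varepsilon$. Weak convergence means convergence of integrals of all bounded continuous functions. A set $\mathcal{M}$ of such measures is uniformly tight if for every $\varepsilon>0$ there is a compact set $K\subset Z$ with $\mu(Z\setminus K)<\varepsilon$ for all $\mu\in\mathcal{M}$. A completely regular space is sequentially Prohorov if every sequence of Radon probability measures on it weakly converging to a Radon measure is uniformly tight. $\Pi(\mu,\nu)$ is the set of Radon probability measures $\sigma$ on $X\times Y$ with $\sigma(A\times Y)=\mu(A)$ and $\sigma(X\times B)=\nu(B)$ for all Borel $A\subset X$, $B\subset Y$. For a nonnegative Borel function $h$ on $X\times Y$, $K_h(\mu,\nu)=\inf_{\sigma\in\Pi(\mu,\nu)}\int h\,d\sigma$. *)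

(* Defs.v *)
From HB Require Import structures.
From mathcomp Require Import all_boot all_order all_algebra.
From mathcomp Require Import all_classical all_reals all_analysis.
Import Order.TTheory GRing.Theory Num.Theory.
Import numFieldNormedType.Exports.

Set Implicit Arguments.
Unset Strict Implicit.
Unset Printing Implicit Defensive.

Local Open Scope classical_set_scope.
Local Open Scope ring_scope.
Local Open Scope ereal_scope.

(* The library declares both parts of this instance but not their join. *)
HB.instance Definition _ (X Y : ptopologicalType) := Pointed.on (X * Y)%type.

(* The carrier T with the sigma-algebra generated by its topology. For a
   product, [borel (X * Y)%type] is the Borel sigma-algebra of the product
   topology, which may be strictly larger than the product of the Borel
   sigma-algebras of X and Y. Measurable types are pointed, hence
   [ptopologicalType]; a space that carries a probability is nonempty anyway. *)
Definition borel (T : ptopologicalType) : measurableType (@open T).-sigma :=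
  g_sigma_algebraType (@open T).

(* [completely_regular_space] separates points from closed sets by a coarser
   uniformity; [uniform_separatorP] turns this into separation by continuous
   functions to [0, 1]. It does not include the Hausdorff axiom. *)
Definition completely_regular_hausdorff (T : topologicalType) : Prop :=
  hausdorff_space T /\ completely_regular_space T.

Section radon_measures.
Variables (R : realType) (T : ptopologicalType).
Implicit Type mu : probability (borel T) R.

Definition radon_probability : set (probability (borel T) R) :=
  [set mu | forall B : set (borel T), measurable B ->
    forall e : R, (0 < e)%R ->
    exists K : set T, [/\ compact K, K `<=` B & mu (B `\` K) < e%:E]].

(* The integrals are finite, so convergence in \bar R is convergence in R. *)
Definition weakly_converges (mu_ : nat -> probability (borel T) R) mu : Prop :=
  forall f : T -> R, continuous f -> bounded_fun f ->
    \int[mu_ n]_x (f x)%:E @[n --> \oo] --> \int[mu]_x (f x)%:E.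

Definition uniformly_tight (M : set (probability (borel T) R)) : Prop :=
  forall e : R, (0 < e)%R ->
  exists2 K : set T, compact K & forall mu, M mu -> mu (~` K) < e%:E.

Definition sequentially_prohorov : Prop :=
  completely_regular_hausdorff T /\
  forall (mu_ : nat -> probability (borel T) R) mu,
    (forall n, radon_probability (mu_ n)) -> radon_probability mu ->
    weakly_converges mu_ mu -> uniformly_tight (range mu_).

End radon_measures.

Arguments sequentially_prohorov R T : clear implicits.

Section transport_cost.
Variables (R : realType) (X Y : ptopologicalType).

Definition couplings (mu : probability (borel X) R)
    (nu : probability (borel Y) R) : set (probability (borel (X * Y)%type) R) :=
  [set sigma : probability (borel (X * Y)%type) R |
    [/\ radon_probability sigma,
    forall A : set (borel X), measurable A -> sigma (A `*` [set: Y]) = mu A &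
    forall B : set (borel Y), measurable B -> sigma ([set: X] `*` B) = nu B]].

Definition transport_cost (h : X * Y -> R) (mu : probability (borel X) R)
    (nu : probability (borel Y) R) : \bar R :=
  ereal_inf [set \int[sigma]_z (h z)%:E | sigma in couplings mu nu].

End transport_cost.

(* Main.v *)
Require Import Defs.
From HB Require Import structures.
From mathcomp Require Import all_boot all_order all_algebra.
From mathcomp Require Import finmap.
From mathcomp Require Import all_classical all_reals all_analysis.
From mathcomp Require Import measurable_realfun giry.
From mathcomp Require Import ring lra.
Import Order.TTheory GRing.Theory Num.Theory.
Import numFieldNormedType.Exports.
Set Implicit Arguments.
Unset Strict Implicit.
Unset Printing Implicit Defensive.
Local Open Scope classical_set_scope.
Local Open Scope ring_scope.
Local Open Scope ereal_scope.

(* A coupling sigma of (mu, nu) is turned into a coupling of nearby marginals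
   (mu', nu') by hand.  Choose partitions of unity (phi_i), (psi_j) such that the
   cost oscillates little on each cell phi_i psi_j > 0 inside a compact K x L.
   Shrink the weights s_ij = int phi_i psi_j dsigma to s'_ij with row and column
   sums below p'_i = int phi_i dmu' and q'_j = int psi_j dnu', and take
     sum_ij s'_ij (phi_i mu' / p'_i) x (psi_j nu' / q'_j)
   plus the normalised product of what is left of mu' and nu'.  By tightness and
   weak convergence this changes the integral of a bounded cost by an arbitrarily
   small amount, uniformly in sigma and in both directions between (mu_n, nu_n)
   and (mu, nu); so the bounded problem is stable without duality or compactness
   of the set of couplings.  The truncation of h_n at 2r costs at most the tails
   of a_n and b_n beyond r; the same bound for h follows by transferring the
   truncated excess from the limit marginals to those of index n.

   The couplings above have bounded continuous densities with respect to the
   Radon product E |-> int nu(E_x) dmu(x) on the Borel sets of X x Y, which makes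
   sense because x |-> nu(W_x) is lower semicontinuous for W open. *)

(** * Borel sets and Radon products *)

(** Weak convergence controls integrals of bounded continuous functions and not masses of Borel
    cells; hence the partitions of unity, whose cell masses p_i, q_j, p'_i, q'_j are such integrals.
    The cost itself supplies the cells: finite sums of |f(a, y) - f(x, y)| over a net of points y
    are continuous in x, and a small sum means that a and x are nearly interchangeable in f.

    The limit h is only known to be Borel, so cells are adapted to the bounded cost of one large
    index N, uniformly close to the limit cost on K x L, and serve both directions of the transfer.

    A coupling must be Radon on a sigma-algebra that may exceed the product of the two Borel ones.
    For the Radon product this rests on tubes with closed bases around compact sets, and complete
    regularity of X enters there, in the form of regularity. A bounded density then preserves the
    Radon property. *)

Section borel_sets.
Variable R : realType.
Implicit Types S T : ptopologicalType.

Lemma borel_open T (A : set T) : open A -> measurable (A : set (borel T)).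
Proof. by move=> oA; exact: sub_gen_smallest. Qed.

Lemma borel_closed T (A : set T) : closed A -> measurable (A : set (borel T)).
Proof.
by move=> cA; rewrite -(setCK A); apply: measurableC; apply: borel_open; exact: closed_openC.
Qed.

Lemma borel_compact T (A : set T) :
  hausdorff_space T -> compact A -> measurable (A : set (borel T)).
Proof. by move=> hT cA; apply: borel_closed; exact: compact_closed. Qed.

Lemma continuous_borel_fun S T (f : S -> T) : continuous f ->
  measurable_fun [set: borel S] (f : borel S -> borel T).
Proof.
move=> /continuousP cf.
apply: (@measurability _ _ (borel S) (borel T) setT f (@open T)) => //.
by move=> _ [B oB <-]; rewrite setTI; apply: borel_open; exact: cf.
Qed.

Lemma continuous_borel_real T (f : T -> R) : continuous f ->
  measurable_fun [set: borel T] (f : borel T -> R).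
Proof.
move=> /continuousP cf; apply: (measurability _ (RGenOpens.measurableE R)) => //.
move=> _ [_ [a [b ->] <-]]; rewrite setTI; apply: borel_open.
by apply: cf; exact: interval_open.
Qed.

Lemma lower_semicontinuous_borel T (f : T -> \bar R) : lower_semicontinuous f ->
  measurable_fun [set: borel T] (f : borel T -> \bar R).
Proof.
move=> scif; apply: (measurability _ (ErealGenOInfty.measurableE R)) => //.
move=> _ [_ [a ->] <-]; rewrite setTI; apply: borel_open.
by rewrite preimage_itvoy; move/lower_semicontinuousP : scif; exact.
Qed.

Lemma pairl_continuous (S T : topologicalType) (x : S) : continuous (fun y : T => (x, y)).
Proof. by move=> y; apply: cvg_pair => //=; exact: cvg_cst. Qed.

Lemma pairr_continuous (S T : topologicalType) (y : T) : continuous (fun x : S => (x, y)).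
Proof. by move=> x; apply: cvg_pair => //=; exact: cvg_cst. Qed.

Lemma borel_pairl S T (x : S) : measurable_fun [set: borel T]
  ((fun y : T => (x, y)) : borel T -> borel (S * T)%type).
Proof. by apply: continuous_borel_fun; exact: pairl_continuous. Qed.

Lemma borel_fst S T :
  measurable_fun [set: borel (S * T)%type] (fst : borel (S * T)%type -> borel S).
Proof. by apply: continuous_borel_fun => x; exact: cvg_fst. Qed.

Lemma borel_snd S T :
  measurable_fun [set: borel (S * T)%type] (snd : borel (S * T)%type -> borel T).
Proof. by apply: continuous_borel_fun => x; exact: cvg_snd. Qed.

Lemma borel_setXT S T (A : set (borel S)) : measurable A ->
  measurable (A `*` [set: T] : set (borel (S * T)%type)).
Proof.
move=> mA; rewrite (_ : _ `*` _ = fst @^-1` A).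
  rewrite -[X in measurable X]setTI. exact: borel_fst.
by apply/seteqP; split => -[x y] //= [].
Qed.

Lemma borel_setTX S T (B : set (borel T)) : measurable B ->
  measurable ([set: S] `*` B : set (borel (S * T)%type)).
Proof.
move=> mB; rewrite (_ : _ `*` _ = snd @^-1` B).
  by rewrite -[X in measurable X]setTI; exact: borel_snd.
by apply/seteqP; split => -[x y] //= [].
Qed.

End borel_sets.

Lemma radon_inner_open (R : realType) (T : ptopologicalType)
    (mu : probability (borel T) R) (W : set T) (c : R) :
  hausdorff_space T -> radon_probability mu -> open W -> c%:E < mu W ->
  exists K, [/\ compact K, K `<=` W & c%:E < mu K].
Proof.
move=> hT radon_mu oW cW; have mW := borel_open oW.
have fW : mu W \is a fin_num by exact: fin_num_measure.
have e0 : (0 < fine (mu W) - c)%R by rewrite subr_gt0 -lte_fin fineK.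
have [K [cK KW]] := radon_mu W mW _ e0.
have mK := borel_compact hT cK.
rewrite measureD//; last by rewrite ltey_eq fW.
rewrite (setIidr KW) => muK; exists K; split => //.
have fK : mu K \is a fin_num by exact: fin_num_measure.
rewrite -[X in _ < X](fineK fK) lte_fin; move: muK.
by rewrite -[X in X - _](fineK fW) -[X in _ - X](fineK fK) -EFinB lte_fin; lra.
Qed.

(** The tube lemma, read off from the filter form of compactness of [L]. *)
Lemma near_sub_xsection (S T : topologicalType) (W : set (S * T)) (L : set T)
    (x : S) : open W -> compact L -> L `<=` (fun y => W (x, y)) ->
  \near x, L `<=` (fun y => W (x, y)).
Proof.
move=> oW cL LW; apply: ((compact_near_coveringP L).1 cL) => y Ly.
have : nbhs (x, y) W by apply: open_nbhs_nbhs; split => //; exact: LW.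
case=> -[/= U V] [Ux Vy] UVW; exists (V, U) => //= -[y' x'] [/= Vy' Ux'].
exact: (UVW (x', y')).
Qed.

Lemma compact_setU (T : topologicalType) (A B : set T) :
  compact A -> compact B -> compact (A `|` B).
Proof.
move=> cA cB; rewrite (_ : A `|` B = \big[setU/set0]_(b : bool) if b then A else B).
  by apply: bigsetU_compact => -[].
by rewrite big_bool.
Qed.

Lemma hausdorff_prod (S T : topologicalType) :
  hausdorff_space S -> hausdorff_space T -> hausdorff_space (S * T)%type.
Proof.
move=> hS hT [x y] [x' y'] clxy; congr pair.
- apply: hS => A B Ax Bx.
  have [//|//|z [/= Az Bz]] := clxy (fst @^-1` A) (fst @^-1` B).
  + exact: cvg_fst.
  + exact: cvg_fst.
  + by exists z.1.
- apply: hT => A B Ay By.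
  have [//|//|z [/= Az Bz]] := clxy (snd @^-1` A) (snd @^-1` B).
  + exact: cvg_snd.
  + exact: cvg_snd.
  + by exists z.2.
Qed.

(** * The Radon product as an integral of section masses *)

Section radon_product.
Context (R : realType) (X Y : ptopologicalType).
Variables (mu : probability (borel X) R) (nu : probability (borel Y) R).
Hypotheses (hX : hausdorff_space X) (hY : hausdorff_space Y).
Hypothesis radon_nu : radon_probability nu.

(** The image of [nu] under the inclusion of the fibre over [x]. As a point of the Giry space it can
    be bound to [mu], and the iterated integral formula then comes from the monad. *)
Let section_measure (x : borel X) : giry (borel (X * Y)%type) R :=
  giry_map (borel_pairl x) nu.

(** Since [nu] is Radon, some compact subset of the section at [x] already has mass above [a]; by
    the tube lemma it stays inside all nearby sections. *)
Lemma xsection_open_lsc (W : set (X * Y)) : open W ->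
  lower_semicontinuous (fun x : X => nu ((fun y : Y => (x, y)) @^-1` W)).
Proof.
move=> oW x a ax; have oS x' : open ((fun y : Y => (x', y)) @^-1` W).
  by apply: open_comp => // y _; exact: pairl_continuous.
have [L [cL LW aL]] := radon_inner_open hY radon_nu (oS x) ax.
exists [set x' | L `<=` (fun y => W (x', y))]; first exact: near_sub_xsection.
move=> x' /= Lx'; apply: lt_le_trans aL _.
by apply: le_measure; rewrite ?inE//; [exact: borel_compact|exact: borel_open].
Qed.

(** Open sets are stable under intersection and generate the Borel sets of the product, so Dynkin's
    theorem reduces measurability to the semicontinuous case. Open sets replace rectangles here,
    because rectangles may generate too few sets. *)
Lemma measurable_section_measure : measurable_fun [set: borel X] section_measure.
Proof.
apply: measurable_giry_codensity => // B.
apply: (@dynkin_induction _ (borel (X * Y)%type) (@open (X * Y)%type)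
  (fun B => measurable_fun [set: borel X] (section_measure ^~ B))) => //=.
- by move=> A C; exact: openI.
- apply: eq_measurable_fun; last exact: measurable_cst (nu setT).
  by move=> x _.
- by move=> W oW; apply: lower_semicontinuous_borel; exact: xsection_open_lsc.
- move=> S mS mfS.
  rewrite (_ : (fun x : borel X => _) = (fun x => 1 - section_measure x S)).
    exact: emeasurable_funB.
  apply/funext => x.
  rewrite /section_measure /giry_map /pushforward/= preimage_setC probability_setC//.
  by rewrite -[X in measurable X]setTI; exact: borel_pairl.
- move=> F mF tF mfF.
  rewrite (_ : (fun x : borel X => _) =
    (fun x => \sum_(0 <= k <oo) section_measure x (F k))).
    have := @ge0_emeasurable_sum _ (borel X) R setT
      (fun k x => section_measure x (F k)) xpredT.
    by apply => // k _; exact: mfF.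
  by apply/funext => x; apply/esym/cvg_lim => //;
    apply: (measure_semi_sigma_additive (s := section_measure x)) => //; exact: bigcupT_measurable.
Qed.

Definition radon_prod : giry (borel (X * Y)%type) R :=
  giry_bind mu measurable_section_measure.

Lemma integral_radon_prod (f : borel (X * Y)%type -> \bar R) :
  measurable_fun setT f -> (forall z, 0 <= f z) ->
  \int[radon_prod]_z f z = \int[mu]_x \int[nu]_y f (x, y).
Proof.
move=> mf f0; rewrite [LHS]giry_int_bind//; apply: eq_integral => x _.
exact: giry_int_map.
Qed.

Lemma radon_prodE (E : set (borel (X * Y)%type)) : measurable E ->
  radon_prod E = \int[mu]_x nu ((fun y : Y => (x, y)) @^-1` E).
Proof.
by move=> mE; rewrite /radon_prod /giry_bind /= giry_int_map//; exact: measurable_giry_ev.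
Qed.

Let radon_prod_setT : radon_prod [set: borel (X * Y)%type] = 1.
Proof.
rewrite radon_prodE// (eq_integral (cst 1)) => [|x _]; last first.
  by rewrite preimage_setT; exact: probability_setT.
by rewrite integral_cst// mul1e; exact: probability_setT.
Qed.

(* The instances below are keyed on a set function, not on a [giry] element. *)
Definition radon_prod_fun : set (borel (X * Y)%type) -> \bar R := radon_prod.

HB.instance Definition _ := Measure.on radon_prod_fun.
HB.instance Definition _ := Measure_isProbability.Build _ _ _ radon_prod_fun radon_prod_setT.

Definition radon_product : probability (borel (X * Y)%type) R := radon_prod_fun.

Lemma integral_radon_product (f : borel (X * Y)%type -> \bar R) :
  measurable_fun setT f -> (forall z, 0 <= f z) ->
  \int[radon_product]_z f z = \int[mu]_x \int[nu]_y f (x, y).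
Proof. exact: integral_radon_prod. Qed.

End radon_product.
Arguments radon_product {R X Y} mu {nu}.

(** * Reduction of the Radon property to open sets *)

Section radon_of_open.
Context (R : realType) (T : ptopologicalType).
Variable P : probability (borel T) R.
Hypothesis hT : hausdorff_space T.
Hypothesis open_inner_regular : forall W : set T, open W ->
  forall e : R, (0 < e)%R -> exists K, [/\ compact K, K `<=` W & P (W `\` K) < e%:E].

(** Approximation from both sides is symmetric under complement, which inner approximation alone is
    not; this makes the class a sigma-algebra. *)
Let sandwiched : set_system (borel T) := [set E | forall e : R, (0 < e)%R ->
  exists F G : set T, [/\ closed F, open G, F `<=` E, E `<=` G & P (G `\` F) < e%:E]].

Let sandwichedC E : sandwiched E -> sandwiched (~` E).
Proof.
move=> sE e e0; have [F [G [cF oG FE EG GF]]] := sE e e0.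
exists (~` G), (~` F); split.
- exact: open_closedC.
- exact: closed_openC.
- exact: subsetC.
- exact: subsetC.
- by rewrite setDE setCK setIC -setDE.
Qed.

Let sandwiched_bigcup (E : (set (borel T))^nat) :
  (forall n, sandwiched (E n)) -> sandwiched (\bigcup_n E n).
Proof.
move=> sE e e0.
have e20 : (0 < e / 2)%R by rewrite divr_gt0.
have /choice[FG FGE] : forall n, exists FG : set T * set T,
    [/\ closed FG.1, open FG.2, FG.1 `<=` E n, E n `<=` FG.2 &
      P (FG.2 `\` FG.1) < (e / 2 / (2 ^ n.+1)%:R)%:E].
  move=> n; have en0 : (0 < e / 2 / (2 ^ n.+1)%:R)%R.
    by rewrite divr_gt0// ltr0n expn_gt0.
  by have [F [G FG]] := sE n _ en0; exists (F, G).
pose F n := (FG n).1; pose G n := (FG n).2.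
have cF n : closed (F n) by have [] := FGE n.
have oG n : open (G n) by have [] := FGE n.
have mF n : measurable (F n : set (borel T)) by exact: borel_closed.
have mG n : measurable (G n : set (borel T)) by exact: borel_open.
(* The union of all [F n] need not be closed, so it is cut at [N]. The gaps [H N] decrease to a set
   inside the union of the [G n] minus [F n], of mass at most [e / 2], hence some [H N] has mass
   below [e]. *)
pose H N : set (borel T) := \bigcup_n G n `\` \bigcup_(i < N) F i.
have mH N : measurable (H N).
  apply: measurableD; first exact: bigcupT_measurable.
  by apply: bigcup_measurable => k _; exact: mF.
have niH : nonincreasing_seq H.
  move=> n m nm; apply/subsetPset; apply: setDS => x [k /= kn Fx].
  by exists k => //=; exact: leq_trans kn nm.
have mHoo : measurable (\bigcap_n H n) by exact: bigcapT_measurable.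
have PHoo : P (\bigcap_n H n) < e%:E.
  apply: (@le_lt_trans _ _ (e / 2)%:E); last by rewrite lte_fin; lra.
  apply: (@le_trans _ _ (\sum_(n <oo) P (G n `\` F n))).
    apply: measure_sigma_subadditive => //.
      by move=> n; exact: measurableD.
    move=> x Hx; have [[n _ Gx] _] := Hx 0%N I; exists n => //; split => // Fx.
    by have [_] := Hx n.+1 I; apply; exists n => //=.
  apply: le_trans (epsilon_trick0 xpredT (ltW e20)).
  by apply: lee_nneseries => // n _; have [_ _ _ _ /ltW] := FGE n.
have cvgPH : P \o H @ \oo --> P (\bigcap_n H n).
  apply: nonincreasing_cvg_mu => //.
  by rewrite (le_lt_trans (probability_le1 _ _))// ltry.
have [N HN] : exists N, P (H N) < e%:E.
  have /(cvgPH _) : nbhs (P (\bigcap_n H n)) [set y | y < e%:E].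
    by apply: open_nbhs_nbhs; split => //; exact: open_ereal_lt_ereal.
  by case=> N _ /(_ N (leqnn N)) HN; exists N.
exists (\bigcup_(i < N) F i), (\bigcup_n G n); split.
- by apply: closed_bigcup => // i _; exact: cF.
- by apply: bigcup_open => i _; exact: oG.
- by move=> x [i _ Fx]; exists i => //; have [_ _ + _ _] := FGE i; exact.
- by move=> x [i _ Ex]; exists i => //; have [_ _ _ + _] := FGE i; exact.
- exact: HN.
Qed.

(** Open sets are sandwiched between a compact subset and themselves, hence all Borel sets are
    sandwiched. The closed inner set becomes compact after intersection with a compact set of almost
    full mass. *)
Lemma radon_probability_open : radon_probability P.
Proof.
have sall : @measurable _ (borel T) `<=` sandwiched.
  apply: smallest_sub; first split.
  - move=> e e0; exists set0, set0; split; rewrite ?setD0 ?measure0//.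
      exact: closed0.
    exact: open0.
  - by move=> A sA; rewrite setTD; exact: sandwichedC.
  - exact: sandwiched_bigcup.
  move=> W oW e e0; have [K [cK KW PK]] := open_inner_regular oW e0.
  by exists K, W; split => //; exact: compact_closed.
move=> B mB e e0.
have e20 : (0 < e / 2)%R by rewrite divr_gt0.
have [F [G [cF oG FB BG GF]]] := sall _ mB _ e20.
have [K [cK _ PK]] := open_inner_regular (@openT T) e20.
have mK := borel_compact hT cK.
exists (K `&` F); split.
- apply: (subclosed_compact _ cK) => [|x []//].
  by apply: closedI => //; exact: compact_closed.
- by move=> x [_ /FB].
have mF : measurable (F : set (borel T)) by exact: borel_closed.
have mG : measurable (G : set (borel T)) by exact: borel_open.
apply: (@le_lt_trans _ _ (P ((G `\` F) `|` ([set: T] `\` K)))).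
  apply: le_measure; rewrite ?inE.
  - by apply: measurableD => //; exact: measurableI.
  - by apply: measurableU; exact: measurableD.
  - move=> x [Bx KFx]; have [Kx|Kx] := pselect (K x); last by right.
    by left; split; [exact: BG|move=> Fx; apply: KFx].
apply: le_lt_trans (measureU2 _ _ _) _; try exact: measurableD.
by rewrite [in ltRHS](splitr e) EFinD lteD.
Qed.

End radon_of_open.

(** * Inner regularity of the Radon product *)

Section radon_product_regular.
Context (R : realType) (X Y : ptopologicalType).
Variables (mu : probability (borel X) R) (nu : probability (borel Y) R).
Hypotheses (hX : hausdorff_space X) (hY : hausdorff_space Y).
Hypothesis regX : regular_space X.
Hypotheses (radon_mu : radon_probability mu) (radon_nu : radon_probability nu).

Local Notation sect x E := ((fun y : Y => (x, y)) @^-1` E).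
Local Notation P := (radon_product mu hY radon_nu).

Let open_sect (W : set (X * Y)) x : open W -> open (sect x W).
Proof. by move=> oW; apply: open_comp => // y _; exact: pairl_continuous. Qed.

(** Regularity of [X] shrinks the base of the tube so that even its closure fits; intersected with a
    compact set, this closed base gives a compact rectangle inside [W]. *)
Let tube (W : set (X * Y)) (x : X) (c : R) : open W -> c%:E < nu (sect x W) ->
  exists VL : set X * set Y, [/\ open VL.1, VL.1 x, compact VL.2,
    closure VL.1 `*` VL.2 `<=` W & c%:E < nu VL.2].
Proof.
move=> oW cW.
have [L [cL LW cnL]] := radon_inner_open hY radon_nu (open_sect x oW) cW.
have [V xV VL] := regX (near_sub_xsection oW cL LW).
exists (V^°, L); split => //=.
  exact: open_interior.
move=> -[x' y'] [/= Vx' Ly'].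
by apply: (VL x') => //; apply: closureS Vx'; exact: interior_subset.
Qed.

(** Finitely many tube bases cover [K]; the union of the corresponding compact rectangles over [K]
    is the required set. *)
Let tube_compact (W : set (X * Y)) (K : set X) (c : R) : open W -> compact K ->
  (forall x, K x -> c%:E < nu (sect x W)) ->
  exists C, [/\ compact C, C `<=` W & forall x, K x -> c%:E < nu (sect x C)].
Proof.
move=> oW cK KW.
have /choice[VL VLP] : forall x, exists VL : set X * set Y, K x ->
    [/\ open VL.1, VL.1 x, compact VL.2, closure VL.1 `*` VL.2 `<=` W & c%:E < nu VL.2].
  move=> x; have [Kx|nKx] := pselect (K x); last by exists (set0, set0).
  by have [VL] := tube oW (KW x Kx); exists VL.
have := cK; rewrite compact_cover => /(_ X K (fun x => (VL x).1)).
case=> [x /VLP[]//|x Kx|D DK KD].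
  by exists x => //; have [] := VLP x Kx.
have KDm x : [set` D] x -> K x by move=> xD; apply/set_mem; exact: DK.
pose B x := (K `&` closure (VL x).1) `*` (VL x).2.
have cB x : K x -> compact (B x).
  move=> /VLP[_ _ cL _ _]; apply: compact_setX => //.
  apply: (subclosed_compact _ cK) => [|z []//].
  by apply: closedI; [exact: compact_closed|exact: closed_closure].
have cC : compact (\bigcup_(x in [set` D]) B x).
  rewrite bigcup_fset big_seq; apply: bigsetU_compact => x xD.
  by apply: cB; exact: KDm.
exists (\bigcup_(x in [set` D]) B x); split => //.
- move=> z [x xD [[_ Vz1] Lz2]]; have [_ _ _ + _] := VLP x (KDm x xD).
  by apply; split.
- move=> x Kx; have [x' x'D Vx] := KD x Kx.
  have [_ _ cL _ cnL] := VLP x' (KDm x' x'D).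
  apply: lt_le_trans cnL _; apply: le_measure; rewrite ?inE.
  + exact: borel_compact.
  + rewrite -[X in measurable X]setTI; apply: borel_pairl => //.
    by apply: borel_compact => //; exact: hausdorff_prod.
  + move=> y Ly; exists x' => //; split => //=; split => //.
    exact: subset_closure.
Qed.

Lemma radon_product_radon : radon_probability P.
Proof.
have hXY : hausdorff_space (X * Y)%type by exact: hausdorff_prod.
apply: radon_probability_open => // W oW e e0.
have mW : measurable (W : set (borel (X * Y)%type)) by exact: borel_open.
pose S := ereal_sup [set P C | C in [set C : set (X * Y) | compact C /\ C `<=` W]].
have leS C : compact C -> C `<=` W -> P C <= S.
  by move=> cC CW; apply: ereal_sup_ubound; exists C.
have S0 : 0 <= S.
  by rewrite (le_trans _ (leS set0 _ _))//; exact: compact0.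
have S1 : S <= 1.
  apply: ub_ereal_sup => _ [C [cC _] <-]; apply: probability_le1.
  exact: borel_compact.
have fS : S \is a fin_num by rewrite ge0_fin_numE// (le_lt_trans S1)// ltry.
have fP E : measurable (E : set (borel (X * Y)%type)) -> P E \is a fin_num.
  by move=> mE; exact: fin_num_measure.
have PDE C : compact C -> C `<=` W -> P (W `\` C) = P W - P C.
  move=> cC CW; rewrite measureD//; first by rewrite (setIidr CW).
  - exact: borel_compact.
  - by rewrite ltey_eq fP.
(* If [P W] exceeded the supremum [S] over compact subsets of [W], the open set
   [W `\` C0], for [C0] nearly optimal, would contain a further compact set of
   mass above [s / 2 * (s / 4)], where [s = P W - S]. *)
suff PWS : P W <= S.
  have [_ [C [cC CW] <-] SC] := ub_ereal_sup_adherent e0 fS.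
  have fPC : P C \is a fin_num by apply: fP; exact: borel_compact.
  exists C; split => //; rewrite PDE// lteBlDl//.
  by rewrite (le_lt_trans PWS)// -lteBlDr.
rewrite leNgt; apply/negP => SPW.
pose s := (fine (P W) - fine S)%R.
have s0 : (0 < s)%R by rewrite subr_gt0 fine_lt ?fP.
have e1 : (0 < s / 2 * (s / 4))%R by rewrite !mulr_gt0// invr_gt0.
have [_ [C0 [cC0 C0W] <-] SC0] := ub_ereal_sup_adherent e1 fS.
have mC0 : measurable (C0 : set (borel (X * Y)%type)) by exact: borel_compact.
have oW' : open (W `\` C0).
  by rewrite setDE; apply: openI => //; apply: closed_openC; exact: compact_closed.
have mW' : measurable (W `\` C0 : set (borel (X * Y)%type)) by exact: measurableD.
have PW' : s%:E <= P (W `\` C0).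
  rewrite PDE// EFinB !fineK ?fP//; apply: leeB => //; exact: leS.
pose g x := nu (sect x (W `\` C0)).
have mg : measurable_fun [set: borel X] g.
  by apply: lower_semicontinuous_borel; exact: xsection_open_lsc.
pose D : set X := [set x | (s / 2)%:E < g x].
have oD : open D.
  by have /lower_semicontinuousP := xsection_open_lsc hY radon_nu oW'; exact.
have mD : measurable (D : set (borel X)) by exact: borel_open.
have muD : (s / 2)%:E <= mu D.
  (* The section mass [g] is at most 1 on [D] and at most [s / 2] off it, while its integral is at
     least [s]. *)
  have : s%:E <= \int[mu]_x ((\1_D x)%:E + (s / 2)%:E).
    apply: le_trans PW' _; rewrite [leLHS]radon_prodE//.
    apply: ge0_le_integral => //.
    - by apply: emeasurable_funD => //; exact/measurable_EFinP/measurable_indic.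
    - move=> x _; rewrite indicE; have [Dx|nDx] := boolP (x \in D).
        rewrite /= (@le_trans _ _ 1)//; last by rewrite leeDl// lee_fin ltW// divr_gt0.
        apply: probability_le1; apply: borel_open; exact: open_sect.
      by move: nDx; rewrite notin_setE /D /= => /negP; rewrite -leNgt add0e.
  rewrite ge0_integralD//; last first.
  - by move=> x _; rewrite lee_fin ltW// divr_gt0.
  - exact/measurable_EFinP/measurable_indic.
  rewrite integral_indic// setIT integral_cst//= [mu setT]probability_setT mule1.
  have fD : mu D \is a fin_num by exact: fin_num_measure.
  by rewrite -(fineK fD) -EFinD !lee_fin; lra.
have [K [cK KD muK4]] : exists K, [/\ compact K, K `<=` D & (s / 4)%:E < mu K].
  apply: radon_inner_open => //; apply: lt_le_trans muD.
  by rewrite lte_fin; lra.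
have mK : measurable (K : set (borel X)) by exact: borel_compact.
have [C' [cC' C'W' nuC']] := tube_compact oW' cK KD.
have mC' : measurable (C' : set (borel (X * Y)%type)) by exact: borel_compact.
have PC' : (s / 2 * (s / 4))%:E < P C'.
  apply: (@lt_le_trans _ _ ((s / 2)%:E * mu K)).
    by rewrite EFinM lte_pmul2l// lte_fin divr_gt0.
  rewrite [leRHS]radon_prodE// -integral_cst//.
  have msC' : measurable_fun [set: borel X] (fun x => nu (sect x C')).
    exact: measurableT_comp (measurable_giry_ev mC') (measurable_section_measure hY radon_nu).
  apply: (@le_trans _ _ (\int[mu]_(x in K) nu (sect x C'))); last first.
    exact: ge0_subset_integral.
  apply: ge0_le_integral => //.
  - by move=> x _; rewrite lee_fin ltW// divr_gt0.
  - exact: measurable_funTS.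
  - by move=> x Kx; rewrite ltW//; exact: nuC'.
have : P (C0 `|` C') <= S.
  by apply: leS; [exact: compact_setU|move=> z [/C0W|/C'W'[]]].
rewrite measureU//; last by apply/seteqP; split => z //= [? /C'W'[]].
rewrite leNgt => /negP; apply.
move: SC0; rewrite lteBlDr// => /lt_le_trans; apply.
by rewrite leeD2l// ltW.
Qed.

End radon_product_regular.

(** * Couplings with a tensor density *)

Section density_probability.
Context d (T : measurableType d) (R : realType).
Variables (P : probability T R) (rho : T -> R).
Hypotheses (mrho : measurable_fun [set: T] rho) (rho0 : forall z, (0 <= rho z)%R).
Hypothesis int_rho : \int[P]_z (rho z)%:E = 1.

Definition density_fun (E : set T) : \bar R := \int[P]_(z in E) (rho z)%:E.

Let mErho E : measurable_fun E (EFin \o rho).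
Proof. by apply: measurable_funTS; exact/measurable_EFinP. Qed.

Let density_fun0 : density_fun set0 = 0. Proof. exact: integral_set0. Qed.

Let density_fun_ge0 E : 0 <= density_fun E.
Proof. by apply: integral_ge0 => z _; rewrite lee_fin. Qed.

Let density_fun_sigma_additive : semi_sigma_additive density_fun.
Proof.
move=> F mF tF mUF; rewrite /density_fun ge0_integral_bigcup//; last first.
  by move=> z _; rewrite lee_fin.
by apply: is_cvg_ereal_nneg_natsum_cond => n _ _; exact: density_fun_ge0.
Qed.

HB.instance Definition _ := isMeasure.Build _ _ _ density_fun
  density_fun0 density_fun_ge0 density_fun_sigma_additive.

Let density_funT : density_fun [set: T] = 1. Proof. exact: int_rho. Qed.

HB.instance Definition _ := Measure_isProbability.Build _ _ _ density_fun density_funT.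

Definition density_probability : probability T R := density_fun.

Import HBNNSimple.

Let integral_density_nnsfun (f : {nnsfun T >-> R}) :
  \int[density_probability]_z (f z)%:E = \int[P]_z ((f z)%:E * (rho z)%:E).
Proof.
transitivity (\int[P]_z (\sum_(y \in range f)
    (y * \1_(f @^-1` [set y]) z)%:E * (rho z)%:E)); last first.
  apply: eq_integral => z _; rewrite -ge0_mule_fsuml; last first.
    by move=> y; exact: nnfun_muleindic_ge0.
  by rewrite fsumEFin// -fimfunE.
rewrite ge0_integral_fsum//; last 2 first.
- move=> y; apply: emeasurable_funM => //; exact/measurable_EFinP/measurable_funM.
- move=> y z _; rewrite mule_ge0// ?lee_fin//; exact: nnfun_muleindic_ge0.
rewrite integralT_nnsfun sintegralE; apply: eq_fsbigr => r rf.
have mfr : measurable (f @^-1` [set r]) by exact: measurable_sfunP.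
have r0 : (0 <= r)%R by move/set_mem : rf => [z _ <-].
under eq_integral do rewrite EFinM -muleA.
rewrite ge0_integralZl//.
- congr *%E; rewrite [LHS]integral_mkcond; apply: eq_integral => z _.
  by rewrite epatch_indic muleC.
- apply: emeasurable_funM => //; exact/measurable_EFinP/measurable_indic.
- by move=> z _; rewrite mule_ge0// lee_fin.
Qed.

Lemma ge0_integral_density (f : T -> \bar R) :
  measurable_fun [set: T] f -> (forall z, 0 <= f z) ->
  \int[density_probability]_z f z = \int[P]_z (f z * (rho z)%:E).
Proof.
move=> mf f0; pose h := nnsfun_approx measurableT mf.
transitivity (limn (fun n => \int[density_probability]_z (h n z)%:E)).
  rewrite -monotone_convergence//.
  - apply: eq_integral => z _; apply/esym/cvg_lim => //; exact: cvg_nnsfun_approx.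
  - by move=> n; exact/measurable_EFinP.
  - by move=> n z _; rewrite lee_fin.
  - by move=> z _ a b ab; rewrite lee_fin; exact/lefP/nd_nnsfun_approx.
under eq_fun do rewrite integral_density_nnsfun.
rewrite -monotone_convergence//.
- apply: eq_integral => z _; apply/cvg_lim => //; apply: cvgeZr => //.
  exact: cvg_nnsfun_approx.
- by move=> n; apply: emeasurable_funM => //; exact/measurable_EFinP.
- by move=> n z _; rewrite mule_ge0// lee_fin.
- by move=> z _ a b ab; rewrite lee_wpmul2r ?lee_fin//; exact/lefP/nd_nnsfun_approx.
Qed.

End density_probability.

Lemma radon_density (R : realType) (T : ptopologicalType)
    (P : probability (borel T) R) (rho : borel T -> R) (C : R)
    (mrho : measurable_fun [set: borel T] rho) (rho0 : forall z, (0 <= rho z)%R)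
    (int_rho : \int[P]_z (rho z)%:E = 1) :
  hausdorff_space T -> (forall z, (rho z <= C)%R) -> radon_probability P ->
  radon_probability (density_probability mrho rho0 int_rho).
Proof.
move=> hT rhoC radonP B mB e e0.
have C0 : (0 <= C)%R by rewrite (le_trans (rho0 point)).
(* The new measure is at most [C] times [P]; the added 1 gives a positive denominator from [0 <= C]
   alone. *)
have eC0 : (0 < e / (C + 1))%R by rewrite divr_gt0// ltr_wpDl.
have [K [cK KB PK]] := radonP B mB _ eC0; exists K; split => //.
have mBK : measurable (B `\` K) by apply: measurableD => //; exact: borel_compact.
apply: (@le_lt_trans _ _ (C%:E * P (B `\` K))).
  rewrite -integral_cst//; apply: ge0_le_integral => //.
  - by move=> z _; rewrite lee_fin.
  - by apply: measurable_funTS; exact/measurable_EFinP.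
  - by move=> z _; rewrite lee_fin.
apply: (@le_lt_trans _ _ (C%:E * (e / (C + 1))%:E)); first by rewrite lee_wpmul2l// ltW.
by rewrite -EFinM lte_fin mulrCA gtr_pMr// ltr_pdivrMr ?ltr_wpDl// mul1r ltrDl.
Qed.

Section tensor_coupling.
Context (R : realType) (X Y : ptopologicalType).
Variables (mu : probability (borel X) R) (nu : probability (borel Y) R).
Hypotheses (hX : hausdorff_space X) (hY : hausdorff_space Y).
Hypothesis regX : regular_space X.
Hypotheses (radon_mu : radon_probability mu) (radon_nu : radon_probability nu).

Local Notation P := (radon_product mu hY radon_nu).

Lemma measurable_tensor (f : borel X -> R) (g : borel Y -> R) :
  measurable_fun [set: borel X] f -> measurable_fun [set: borel Y] g ->
  measurable_fun [set: borel (X * Y)%type] (fun z => (f z.1 * g z.2)%R).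
Proof.
move=> mf mg; apply: measurable_funM.
  exact: (measurableT_comp mf (@borel_fst X Y)).
exact: (measurableT_comp mg (@borel_snd X Y)).
Qed.

Lemma integral_tensor (f : borel X -> R) (g : borel Y -> R) :
  measurable_fun [set: borel X] f -> measurable_fun [set: borel Y] g ->
  (forall x, (0 <= f x)%R) -> (forall y, (0 <= g y)%R) ->
  \int[P]_z (f z.1 * g z.2)%:E = \int[mu]_x (f x)%:E * \int[nu]_y (g y)%:E.
Proof.
move=> mf mg f0 g0; rewrite integral_radon_product//; last 2 first.
- by apply/measurable_EFinP; exact: (measurable_tensor mf mg).
- by move=> z; rewrite lee_fin mulr_ge0.
rewrite -ge0_integralZr//; last 3 first.
- exact/measurable_EFinP.
- by move=> x _; rewrite lee_fin.
- by apply: integral_ge0 => y _; rewrite lee_fin.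
apply: eq_integral => x _.
under eq_integral do rewrite EFinM.
rewrite /= ge0_integralZl ?lee_fin//; first exact/measurable_EFinP.
by move=> y _; rewrite lee_fin.
Qed.

Variables (I : finType) (w u v : I -> R) (F : I -> X -> R) (G : I -> Y -> R).
Hypotheses (w0 : forall i, (0 <= w i)%R).
Hypotheses (mF : forall i, measurable_fun [set: borel X] (F i)).
Hypotheses (mG : forall i, measurable_fun [set: borel Y] (G i)).
Hypotheses (F0 : forall i x, (0 <= F i x)%R) (F1 : forall i x, (F i x <= 1)%R).
Hypotheses (G0 : forall i y, (0 <= G i y)%R) (G1 : forall i y, (G i y <= 1)%R).
Hypotheses (int_F : forall i, \int[mu]_x (F i x)%:E = (u i)%:E).
Hypotheses (int_G : forall i, \int[nu]_y (G i y)%:E = (v i)%:E).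
Hypotheses (sumF : forall x, (\sum_i w i * v i * F i x = 1)%R).
Hypotheses (sumG : forall y, (\sum_i w i * u i * G i y = 1)%R).

(** The density of the sum of the products [w i] ([F i] mu) x ([G i] nu). Integrating out the second
    variable turns its i-th term into [w i * v i * F i x], so [sumF] says that the first marginal
    has density 1; [sumG] does the same for the second. *)
Let rho (z : borel (X * Y)%type) : R := (\sum_i w i * (F i z.1 * G i z.2))%R.

Let mterm i : measurable_fun [set: borel (X * Y)%type]
  (fun z => (w i * (F i z.1 * G i z.2))%R).
Proof. by apply: measurable_funM => //; exact: (measurable_tensor (mF i) (mG i)). Qed.

Let mrho : measurable_fun [set: borel (X * Y)%type] rho.
Proof. by apply: measurable_sum => i; exact: mterm. Qed.

Let rho0 z : (0 <= rho z)%R.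
Proof. by apply: sumr_ge0 => i _; rewrite !mulr_ge0. Qed.

Let rho_le z : (rho z <= \sum_i w i)%R.
Proof.
by apply: ler_sum => i _; rewrite ler_piMr// mulr_ile1.
Qed.

Let integral_rho (f : borel X -> R) (g : borel Y -> R) :
  measurable_fun [set: borel X] f -> measurable_fun [set: borel Y] g ->
  (forall x, (0 <= f x)%R) -> (forall y, (0 <= g y)%R) ->
  \int[P]_z (f z.1 * g z.2 * rho z)%:E =
  \sum_i (w i)%:E * (\int[mu]_x (f x * F i x)%:E * \int[nu]_y (g y * G i y)%:E).
Proof.
move=> mf mg f0 g0.
under eq_integral.
  move=> z _; rewrite /rho mulr_sumr -sumEFin.
  under eq_bigr do rewrite mulrCA mulrACA EFinM.
  over.
have mfF i : measurable_fun [set: borel X] (fun x => (f x * F i x)%R) by exact: measurable_funM.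
have mgG i : measurable_fun [set: borel Y] (fun y => (g y * G i y)%R) by exact: measurable_funM.
rewrite ge0_integral_sum//; last 2 first.
- move=> i; apply: measurable_funeM; apply/measurable_EFinP.
  exact: (measurable_tensor (mfF i) (mgG i)).
- by move=> i z _; rewrite -EFinM lee_fin !mulr_ge0.
apply: eq_bigr => i _; rewrite ge0_integralZl ?lee_fin//.
- rewrite -(integral_tensor (mfF i) (mgG i))// => [x|y]; exact: mulr_ge0.
- by apply/measurable_EFinP; exact: (measurable_tensor (mfF i) (mgG i)).
- by move=> z _; rewrite lee_fin !mulr_ge0.
Qed.

Let u0 i : (0 <= u i)%R.
Proof. by rewrite -lee_fin -int_F; apply: integral_ge0 => x _; rewrite lee_fin. Qed.

Let v0 i : (0 <= v i)%R.
Proof. by rewrite -lee_fin -int_G; apply: integral_ge0 => y _; rewrite lee_fin. Qed.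

Let integral_partition d (T : measurableType d) (m : probability T R)
    (a : I -> R) (H : I -> T -> R) (f : T -> R) :
  measurable_fun [set: T] f -> (forall x, (0 <= f x)%R) ->
  (forall i, measurable_fun [set: T] (H i)) -> (forall i x, (0 <= H i x)%R) ->
  (forall i, (0 <= a i)%R) -> (forall x, (\sum_i a i * H i x = 1)%R) ->
  \sum_i (a i)%:E * \int[m]_x (f x * H i x)%:E = \int[m]_x (f x)%:E.
Proof.
move=> mf f0 mH H0 a0 sumH.
have mfH i : measurable_fun [set: T] (fun x => (f x * H i x)%:E).
  by apply/measurable_EFinP; exact: measurable_funM.
transitivity (\int[m]_x \sum_i (a i)%:E * (f x * H i x)%:E); last first.
  apply: eq_integral => x _; rewrite sumEFin.
  by under eq_bigr do rewrite mulrCA; rewrite -mulr_sumr sumH mulr1.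
rewrite ge0_integral_sum//; last 2 first.
- by move=> i; exact: measurable_funeM.
- by move=> i x _; rewrite lee_fin !mulr_ge0.
apply: eq_bigr => i _; rewrite ge0_integralZl ?lee_fin//.
by move=> x _; rewrite lee_fin mulr_ge0.
Qed.

Let marginal1 (f : borel X -> R) : measurable_fun [set: borel X] f ->
  (forall x, (0 <= f x)%R) ->
  \int[P]_z (f z.1 * rho z)%:E = \int[mu]_x (f x)%:E.
Proof.
move=> mf f0.
rewrite -(integral_partition mu mf f0 mF F0 (fun i => mulr_ge0 (w0 i) (v0 i)) sumF).
transitivity (\int[P]_z (f z.1 * cst 1%R z.2 * rho z)%:E).
  by apply: eq_integral => z _; rewrite mulr1.
rewrite integral_rho//; apply: eq_bigr => i _.
under [X in _ * (_ * X)]eq_integral do rewrite mul1r.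
by rewrite int_G EFinM -muleA [X in _ * X]muleC.
Qed.

Let marginal2 (g : borel Y -> R) : measurable_fun [set: borel Y] g ->
  (forall y, (0 <= g y)%R) ->
  \int[P]_z (g z.2 * rho z)%:E = \int[nu]_y (g y)%:E.
Proof.
move=> mg g0.
rewrite -(integral_partition nu mg g0 mG G0 (fun i => mulr_ge0 (w0 i) (u0 i)) sumG).
transitivity (\int[P]_z (cst 1%R z.1 * g z.2 * rho z)%:E).
  by apply: eq_integral => z _; rewrite mul1r.
rewrite integral_rho//; apply: eq_bigr => i _.
under [X in _ * (X * _)]eq_integral do rewrite mul1r.
by rewrite int_F EFinM -muleA.
Qed.

Let int_rho1 : \int[P]_z (rho z)%:E = 1.
Proof.
transitivity (\int[P]_z (cst 1%R z.1 * rho z)%:E).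
  by apply: eq_integral => z _; rewrite mul1r.
rewrite marginal1// (eq_integral (cst 1))// integral_cst// mul1e.
exact: probability_setT.
Qed.

Definition tensor_coupling : probability (borel (X * Y)%type) R :=
  density_probability mrho rho0 int_rho1.

Lemma tensor_couplingP : couplings mu nu tensor_coupling.
Proof.
split.
- apply: radon_density rho_le _; first exact: hausdorff_prod.
  exact: radon_product_radon.
- move=> A mA; transitivity (\int[mu]_x (\1_A x)%:E); last first.
    by rewrite integral_indic// setIT.
  rewrite -marginal1//; rewrite [LHS]integral_mkcond; apply: eq_integral => z _.
  rewrite epatch_indic muleC -EFinM !indicE; congr (_%:R * _)%:E.
  by congr nat_of_bool; apply/idP/idP; rewrite !inE => // -[].
- move=> B mB; transitivity (\int[nu]_y (\1_B y)%:E); last first.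
    by rewrite integral_indic// setIT.
  rewrite -marginal2//; rewrite [LHS]integral_mkcond; apply: eq_integral => z _.
  rewrite epatch_indic muleC -EFinM !indicE; congr (_%:R * _)%:E.
  by congr nat_of_bool; apply/idP/idP; rewrite !inE => // -[].
Qed.

(** Split along [D]. On [D] each term of the density is nonzero only where [g] is at most [c i], and
    its integral factorises into [w i * u i * v i]; off [D] only the bound [M] is available. *)
Lemma integral_tensor_coupling_le (g : borel (X * Y)%type -> R)
    (D : set (borel (X * Y)%type)) (M : R) (c : I -> R) :
  measurable_fun [set: borel (X * Y)%type] g -> measurable D ->
  (forall z, (0 <= g z)%R) -> (forall i, (0 <= c i)%R) ->
  (forall z, (g z <= M)%R) ->
  (forall i z, D z -> (0 < F i z.1)%R -> (0 < G i z.2)%R -> (g z <= c i)%R) ->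
  \int[tensor_coupling]_z (g z)%:E <=
    (\sum_i c i * w i * u i * v i)%:E + M%:E * tensor_coupling (~` D).
Proof.
move=> mg mD g0 c0 gM gc.
have M0 : (0 <= M)%R by rewrite (le_trans (g0 point)).
rewrite ge0_integral_density; last 2 first.
- exact/measurable_EFinP.
- by move=> z; rewrite lee_fin.
have mtens i : measurable_fun [set: borel (X * Y)%type] (fun z => (F i z.1 * G i z.2)%R).
  exact: (measurable_tensor (mF i) (mG i)).
pose h z : R := (\sum_i c i * w i * (F i z.1 * G i z.2))%R.
have h0 z : (0 <= h z)%R by apply: sumr_ge0 => i _; rewrite !mulr_ge0.
have mh : measurable_fun [set: borel (X * Y)%type] h.
  by apply: measurable_sum => i; apply: measurable_funM => //; exact: mtens.
apply: (@le_trans _ _ (\int[P]_z ((h z)%:E + M%:E * (\1_(~` D) z * rho z)%:E))).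
  apply: ge0_le_integral => //.
  - by move=> z _; rewrite mule_ge0 ?lee_fin.
  - by apply: emeasurable_funM; exact/measurable_EFinP.
  - apply: emeasurable_funD; first exact/measurable_EFinP.
    apply: measurable_funeM; apply/measurable_EFinP; apply: measurable_funM => //.
    by apply: measurable_indic; exact: measurableC.
  - move=> z _; rewrite -!EFinM -EFinD lee_fin indicE in_setC.
    have [/set_mem Dz|nDz] /= := boolP (z \in D); last first.
      rewrite mul1r (@le_trans _ _ (M * rho z)%R)//; last by rewrite lerDr.
      by rewrite ler_wpM2r.
    rewrite mul0r mulr0 addr0 /rho /h mulr_sumr; apply: ler_sum => i _.
    have [->|Fz] := eqVneq (F i z.1) 0%R; first by rewrite mul0r !mulr0.
    have [->|Gz] := eqVneq (G i z.2) 0%R; first by rewrite !mulr0.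
    rewrite [leLHS]mulrA ler_wpM2r ?mulr_ge0// ler_wpM2r//.
    by apply: gc => //; rewrite lt0r ?Fz ?Gz /=.
rewrite ge0_integralD//; last first.
- apply: measurable_funeM; apply/measurable_EFinP; apply: measurable_funM => //.
  by apply: measurable_indic; exact: measurableC.
- by move=> z _; rewrite mule_ge0 ?lee_fin ?mulr_ge0.
- exact/measurable_EFinP.
- by move=> z _; rewrite lee_fin.
apply: leeD.
  rewrite /h; under eq_integral do rewrite -sumEFin.
  rewrite ge0_integral_sum//; last 2 first.
  - by move=> i; apply/measurable_EFinP; apply: measurable_funM => //; exact: mtens.
  - by move=> i z _; rewrite lee_fin !mulr_ge0.
  rewrite -sumEFin; apply: lee_sum => i _; under eq_integral do rewrite EFinM.
  rewrite ge0_integralZl ?lee_fin ?mulr_ge0//.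
  - by rewrite integral_tensor// int_F int_G !EFinM !muleA.
  - by apply/measurable_EFinP; exact: mtens.
  - by move=> z _; rewrite lee_fin mulr_ge0.
rewrite ge0_integralZl ?lee_fin//.
- apply: lee_wpmul2l; rewrite ?lee_fin// [leRHS]integral_mkcond.
  rewrite le_eqVlt; apply/orP; left; apply/eqP; apply: eq_integral => z _.
  by rewrite epatch_indic muleC -EFinM.
- apply/measurable_EFinP; apply: measurable_funM => //.
  by apply: measurable_indic; exact: measurableC.
- by move=> z _; rewrite lee_fin mulr_ge0.
Qed.

End tensor_coupling.

(** * Transfer of couplings between nearby marginals *)

Section oscillation_partition.
Variable R : realType.

Lemma continuous_sum (T : topologicalType) (I : Type) (s : seq I) (f : I -> T -> R) :
  (forall i, continuous (f i)) -> continuous (fun x => (\sum_(i <- s) f i x)%R).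
Proof.
move=> cf x; elim: s => [|i s IH].
  by rewrite (_ : (fun _ => _) = cst 0%R); [exact: cvg_cst|apply/funext => y; rewrite big_nil].
rewrite (_ : (fun _ => _) = (fun y => f i y + \sum_(j <- s) f j y)%R); last first.
  by apply/funext => y; rewrite big_cons.
exact: continuousD (cf i x) IH.
Qed.

Lemma big_option (I : finType) (F : option I -> R) :
  (\sum_o F o = F None + \sum_i F (Some i))%R.
Proof.
rewrite (bigD1 None)//= (reindex_omap Some id) => [|[i|]]//=.
by congr (_ + _)%R; apply: eq_bigl => i; rewrite eqxx.
Qed.

(* [phi None] absorbs the mass outside the cells and vanishes on [K]. *)
Lemma partition_of_unity_compact (T : ptopologicalType) (d : T -> T -> R)
    (K : set T) (e : R) :
  (0 < e)%R -> (forall a, continuous (d a)) -> (forall a, d a a = 0%R) -> compact K ->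
  exists (I : finType) (a : I -> T) (phi : option I -> T -> R),
    [/\ forall i, K (a i),
        forall i, continuous (phi i),
        forall i x, (0 <= phi i x)%R,
        forall x, (\sum_i phi i x = 1)%R &
        forall x, K x -> phi None x = 0%R /\
          forall i, (0 < phi (Some i) x)%R -> (d (a i) x < e)%R].
Proof.
move=> e0 cd d0 cK.
have cb (b : R) (g : T -> R) : continuous g -> continuous (fun x => Num.max b (g x)).
  by move=> cg x; apply: continuous_max; [exact: cvg_cst|exact: cg].
have := cK; rewrite compact_cover => /(_ T K (fun a => [set x | d a x < e / 2]%R)).
case=> [a Ka|x Kx|D DK KD].
- by apply: open_comp (@open_lt _ (e / 2)%R) => x _; exact: cd.
- by exists x => //=; rewrite d0 divr_gt0.
(* The bump [p a] is positive exactly where [d a x < e]. The cover used radius [e / 2], so on [K]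
   the sum [S] exceeds [e / 2] and the normaliser [N] equals [S] there; elsewhere the floor [e / 2]
   keeps the quotients continuous. *)
pose p (a : D) x : R := Num.max 0%R (e - d (\val a) x)%R.
pose S x : R := (\sum_(a : D) p a x)%R.
pose N x : R := Num.max (e / 2)%R (S x).
have p0 a x : (0 <= p a x)%R by rewrite le_max lexx.
have cp a : continuous (p a).
  by apply: cb => x; apply: cvgB; [exact: cvg_cst|exact: cd].
have cS : continuous S by exact: continuous_sum.
have cN : continuous N by exact: cb.
have N0 x : (0 < N x)%R by rewrite lt_max divr_gt0.
exists D, (fun a => \val a),
  (fun o x => if o is Some a then p a x / N x else (N x - S x) / N x)%R.
split.
- by move=> a; apply/set_mem/DK/fsvalP.
- case=> [a|] x; apply: cvgM; [exact: cp| |apply: cvgB; [exact: cN|exact: cS]|];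
  by apply: cvgV; [rewrite gt_eqF|exact: cN].
- case=> [a|] x; rewrite divr_ge0 ?(ltW (N0 x))// subr_ge0.
  by rewrite le_max lexx orbT.
- move=> x; rewrite big_option -mulr_suml -mulrDl addrNK divff// gt_eqF//.
- move=> x Kx; split.
    suff -> : N x = S x by rewrite subrr mul0r.
    apply/max_idPr; have [a aD /= dax] := KD x Kx.
    rewrite /S (bigD1 [` aD]%fset)//= (@le_trans _ _ (p [` aD]%fset x))//.
      by rewrite le_max; apply/orP; right => /=; move: dax; lra.
    by rewrite lerDl sumr_ge0.
  move=> a; rewrite pmulr_lgt0 ?invr_gt0//.
  by rewrite lt_max ltxx /= subr_gt0.
Qed.

(** Replaces a supremum over all [y] in [L] by finitely many values, so that the oscillation of [f]
    in [x] can be measured by a finite sum, whose continuity in [x] is immediate. *)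
Lemma finite_net_compact (X Y : ptopologicalType) (f : X * Y -> R)
    (K : set X) (L : set Y) (e : R) :
  continuous f -> (0 < e)%R -> compact K -> compact L ->
  exists J : seq Y, forall y, L y -> exists2 y', y' \in J &
    forall x, K x -> (`|f (x, y) - f (x, y')| < e)%R.
Proof.
move=> cf e0 cK cL.
pose V y' : set Y := [set y | forall x, K x -> (`|f (x, y) - f (x, y')| < e)%R].
have V_nbhs y' : nbhs y' (V y').
  apply: (((compact_near_coveringP K).1 cK) _ _
    (fun y x => (`|f (x, y) - f (x, y')| < e)%R)) => x Kx.
  have cg : continuous (fun z : X * Y => f z - f (z.1, y'))%R.
    move=> z; apply: cvgB; first exact: cf.
    apply: (@continuous_comp _ _ _ (fun z : X * Y => (z.1, y')) f); last exact: cf.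
    by apply: cvg_pair => /=; [exact: cvg_fst|exact: cvg_cst].
  have : nbhs (x, y') ((fun z : X * Y => f z - f (z.1, y'))%R @^-1` ball 0%R e).
    by apply: cg; rewrite /= subrr; exact: nbhsx_ballx.
  case=> -[/= A B] [Ax By'] AB; exists (A, B) => //= -[x1 y1] [/= Ax1 By1].
  by have := AB (x1, y1); rewrite /ball/= sub0r normrN; apply.
have := cL; rewrite compact_cover => /(_ Y L (fun y => (V y)^°)).
case=> [y _|y Ly|D DL LD].
- exact: open_interior.
- by exists y => //; exact: V_nbhs.
- exists D => y Ly; have [y' y'D /interior_subset Vy] := LD y Ly.
  by exists y'.
Qed.

(** Cells in [x] are those on which the sections through the net [S] vary little. Once their
    finitely many centres [a i] are fixed, cells in [y] need only control the functions
    [f (a i, _)]. *)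
Lemma oscillation_partition (X Y : ptopologicalType) (f : X * Y -> R)
    (K : set X) (L : set Y) (M e : R) :
  continuous f -> (forall z, 0 <= f z <= M)%R -> (0 < e)%R -> compact K -> compact L ->
  exists (I J : finType) (phi : I -> X -> R) (psi : J -> Y -> R) (c : I -> J -> R),
    [/\ forall i, continuous (phi i), forall j, continuous (psi j) &
    [/\ forall i x, (0 <= phi i x)%R, forall j y, (0 <= psi j y)%R,
        forall x, (\sum_i phi i x = 1)%R & forall y, (\sum_j psi j y = 1)%R] /\
    (forall i j, 0 <= c i j <= M)%R /\
    forall i j x y, K x -> L y -> (0 < phi i x)%R -> (0 < psi j y)%R ->
      (`|f (x, y) - c i j| <= e)%R].
Proof.
move=> cf fM e0 cK cL; have M0 : (0 <= M)%R.
  by have /andP[/le_trans] := fM point; apply.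
have e40 : (0 < e / 4)%R by rewrite divr_gt0.
have [S netS] := finite_net_compact cf e40 cK cL.
have cdist (T : ptopologicalType) (U : eqType) (s : seq U) (g : U -> T -> R) (a : T) :
    (forall u, continuous (g u)) ->
    continuous (fun x => \sum_(u <- s) `|g u a - g u x|)%R.
  move=> cg; apply: continuous_sum => u x; apply: cvg_norm.
  by apply: cvgB; [exact: cvg_cst|exact: cg].
have le_dist (U : eqType) (s : seq U) (g : U -> R) u : u \in s ->
    (forall u, 0 <= g u)%R -> (g u <= \sum_(v <- s) g v)%R.
  by move=> us g0; rewrite (big_rem u)//= lerDl sumr_ge0.
have cf1 y : continuous (fun x => f (x, y)).
  by move=> x; apply: continuous_comp; [exact: pairr_continuous|exact: cf].
have cf2 x : continuous (fun y => f (x, y)).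
  by move=> y; apply: continuous_comp; [exact: pairl_continuous|exact: cf].
pose d1 a x := (\sum_(y <- S) `|f (a, y) - f (x, y)|)%R.
have [I [a [phi [Ka cphi phi0 sphi phiK]]]] : exists (I : finType) (a : I -> X)
    (phi : option I -> X -> R), [/\ forall i, K (a i), forall i, continuous (phi i),
      forall i x, (0 <= phi i x)%R, forall x, (\sum_i phi i x = 1)%R &
      forall x, K x -> phi None x = 0%R /\
        forall i, (0 < phi (Some i) x)%R -> (d1 (a i) x < e / 4)%R].
  apply: partition_of_unity_compact => // [a|a]; first exact: cdist.
  by rewrite /d1 big1// => y _; rewrite subrr normr0.
pose d2 b y := (\sum_(i <- enum I) `|f (a i, b) - f (a i, y)|)%R.
have [J [b [psi [Lb cpsi psi0 spsi psiL]]]] : exists (J : finType) (b : J -> Y)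
    (psi : option J -> Y -> R), [/\ forall j, L (b j), forall j, continuous (psi j),
      forall j y, (0 <= psi j y)%R, forall y, (\sum_j psi j y = 1)%R &
      forall y, L y -> psi None y = 0%R /\
        forall j, (0 < psi (Some j) y)%R -> (d2 (b j) y < e / 4)%R].
  apply: partition_of_unity_compact => // [b|b].
    by apply: (cdist _ _ _ (fun i y => f (a i, y))) => i; exact: cf2.
  by rewrite /d2 big1// => i _; rewrite subrr normr0.
(* The cell constant is the value at the two centres. The value 0 on the remainder cells is
   harmless, since their functions vanish on [K] or on [L]. *)
exists (option I), (option J), phi, psi,
  (fun i j => if i is Some i then if j is Some j then f (a i, b j) else 0%R else 0%R).
split => //; split => //; split.
  by case=> [i|] [j|]; rewrite ?lexx ?M0.
case=> [i|] [j|] x y Kx Ly; have [phiN phiS] := phiK x Kx; have [psiN psiS] := psiL y Ly;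
  rewrite ?phiN ?psiN ?ltxx// => /phiS dx /psiS dy.
(* Four steps of size [e / 4]: from [f (x, y)] to [f (x, y')], [f (a i, y')], [f (a i, y)] and
   [f (a i, b j)]. *)
have [y' y'S yy'] := netS y Ly.
have h1 := yy' x Kx; have h2 := yy' (a i) (Ka i).
have h3 : (`|f (a i, y') - f (x, y')| < e / 4)%R.
  apply: le_lt_trans dx.
  by apply: (@le_dist _ _ (fun y => `|f (a i, y) - f (x, y)|)%R).
have h4 : (`|f (a i, b j) - f (a i, y)| < e / 4)%R.
  apply: le_lt_trans dy.
  by apply: (@le_dist _ _ (fun i => `|f (a i, b j) - f (a i, y)|)%R); rewrite ?mem_enum.
move: h1 h2 h3 h4; rewrite !ltr_norml ler_norml.
by move=> /andP[? ?] /andP[? ?] /andP[? ?] /andP[? ?]; apply/andP; split; lra.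
Qed.

End oscillation_partition.

Section coupling_basics.
Variable R : realType.

(** The factor is min(1, p'/p), and the mass it removes is the positive part of [p - p']. *)
Lemma shrink_factor (p p' : R) : (0 <= p)%R -> (0 <= p')%R ->
  exists m, [/\ (0 <= m <= 1)%R, (m * p <= p')%R & ((1 - m) * p <= `|p - p'|)%R].
Proof.
move=> p0 p'0; have [pp'|p'p] := leP p p'.
  by exists 1%R; rewrite ler01 lexx mul1r subrr mul0r.
have p_gt0 : (0 < p)%R by exact: le_lt_trans p'p.
exists (p' / p)%R; rewrite divr_ge0//= ler_pdivrMr// mul1r (ltW p'p) divfK ?gt_eqF//.
by split => //; rewrite mulrBl mul1r divfK ?gt_eqF// ler_norm.
Qed.

(** Each weight is multiplied by a row factor, a column factor and [1 - d]. The last one leaves at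
    least the mass [d] unassigned, so that the residual product can be normalised. The loss is
    controlled through 1 - m n <= (1 - m) + (1 - n) for m, n in [0, 1]. *)
Lemma shrink_weights (I J : finType) (s : I -> J -> R) (p' : I -> R) (q' : J -> R) (d : R) :
  (0 < d < 1)%R -> (forall i j, 0 <= s i j)%R ->
  (forall i, 0 <= p' i)%R -> (forall j, 0 <= q' j)%R ->
  (\sum_i \sum_j s i j = 1)%R ->
  exists s' : I -> J -> R,
    [/\ forall i j, (0 <= s' i j <= s i j)%R,
        forall i, (\sum_j s' i j <= p' i)%R,
        forall j, (\sum_i s' i j <= q' j)%R &
        (d <= 1 - \sum_i \sum_j s' i j <=
          d + \sum_i `|\sum_j s i j - p' i| + \sum_j `|\sum_i s i j - q' j|)%R].
Proof.
move=> /andP[d0 d1] s0 p'0 q'0 s1.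
have /choice[m mP] : forall i, exists m, [/\ (0 <= m <= 1)%R,
    (m * \sum_j s i j <= p' i)%R &
    ((1 - m) * \sum_j s i j <= `|\sum_j s i j - p' i|)%R].
  by move=> i; apply: shrink_factor => //; exact: sumr_ge0.
have /choice[n nP] : forall j, exists n, [/\ (0 <= n <= 1)%R,
    (n * \sum_i s i j <= q' j)%R &
    ((1 - n) * \sum_i s i j <= `|\sum_i s i j - q' j|)%R].
  by move=> j; apply: shrink_factor => //; exact: sumr_ge0.
have m0 i : (0 <= m i)%R by have [/andP[]] := mP i.
have m1 i : (m i <= 1)%R by have [/andP[]] := mP i.
have n0 j : (0 <= n j)%R by have [/andP[]] := nP j.
have n1 j : (n j <= 1)%R by have [/andP[]] := nP j.
have cd0 : (0 <= 1 - d)%R by rewrite subr_ge0 ltW.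
have cd1 : (1 - d <= 1)%R by rewrite gerBl ltW.
have dn1 j : ((1 - d) * n j <= 1)%R by rewrite mulr_ile1.
have dm1 i : ((1 - d) * m i <= 1)%R by rewrite mulr_ile1.
exists (fun i j => (1 - d) * (s i j * (m i * n j)))%R; split.
- move=> i j; rewrite !mulr_ge0//= mulrCA ler_piMr//.
  by rewrite mulrCA mulr_ile1// mulr_ge0.
- move=> i; have [_ mp _] := mP i; apply: le_trans mp.
  rewrite mulr_sumr; apply: ler_sum => j _.
  rewrite [leLHS](_ : _ = m i * s i j * ((1 - d) * n j))%R; last by ring.
  by rewrite ler_piMr// mulr_ge0.
- move=> j; have [_ nq _] := nP j; apply: le_trans nq.
  rewrite mulr_sumr; apply: ler_sum => i _.
  rewrite [leLHS](_ : _ = n j * s i j * ((1 - d) * m i))%R; last by ring.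
  by rewrite ler_piMr// mulr_ge0.
- under eq_bigr do rewrite -mulr_sumr.
  rewrite -mulr_sumr; set t := (\sum_i \sum_j s i j * (m i * n j))%R.
  have t1 : (t <= 1)%R.
    rewrite -[leRHS]s1; apply: ler_sum => i _; apply: ler_sum => j _.
    by rewrite ler_piMr// mulr_ile1.
  have t0 : (0 <= t)%R.
    by apply: sumr_ge0 => i _; apply: sumr_ge0 => j _; rewrite !mulr_ge0.
  have ts : (1 - t <= \sum_i (1 - m i) * (\sum_j s i j) +
                      \sum_j (1 - n j) * (\sum_i s i j))%R.
    rewrite -[X in (X - t <= _)%R]s1 /t -sumrB.
    under [X in (_ <= X + _)%R]eq_bigr do rewrite mulr_sumr.
    under [X in (_ <= _ + X)%R]eq_bigr do rewrite mulr_sumr.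
    rewrite [X in (_ <= _ + X)%R]exchange_big -big_split/=.
    apply: ler_sum => i _; rewrite -sumrB -big_split/=; apply: ler_sum => j _.
    rewrite -subr_ge0 [leRHS](_ : _ = s i j * ((1 - m i) * (1 - n j)))%R; last by ring.
    by rewrite !mulr_ge0// subr_ge0.
  have le1 : (\sum_i (1 - m i) * (\sum_j s i j) <= \sum_i `|\sum_j s i j - p' i|)%R.
    by apply: ler_sum => i _; have [] := mP i.
  have le2 : (\sum_j (1 - n j) * (\sum_i s i j) <= \sum_j `|\sum_i s i j - q' j|)%R.
    by apply: ler_sum => j _; have [] := nP j.
  apply/andP; split.
    have : ((1 - d) * t <= (1 - d) * 1)%R by rewrite ler_wpM2l.
    lra.
  have : (d * t <= d * 1)%R by rewrite ler_wpM2l// ltW.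
  have -> : ((1 - d) * t = t - d * t)%R by ring.
  lra.
Qed.

Lemma integral_in_unit d (T : measurableType d) (m : probability T R) (f : T -> R) :
  measurable_fun [set: T] f -> (forall x, 0 <= f x <= 1)%R ->
  (fine (\int[m]_x (f x)%:E))%:E = \int[m]_x (f x)%:E.
Proof.
move=> mf f01; apply: fineK; rewrite ge0_fin_numE.
  apply: (@le_lt_trans _ _ (\int[m]_x (cst 1%E x))).
    apply: ge0_le_integral => //.
    - by move=> x _; rewrite lee_fin; have /andP[] := f01 x.
    - exact/measurable_EFinP.
    - by move=> x _; rewrite lee_fin; have /andP[] := f01 x.
  by rewrite integral_cst// mul1e (le_lt_trans (probability_le1 _ _))// ltry.
by apply: integral_ge0 => x _; rewrite lee_fin; have /andP[] := f01 x.
Qed.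

Variables X Y : ptopologicalType.

Section couplings_theory.
Variables (mu : probability (borel X) R) (nu : probability (borel Y) R).
Variable sigma : probability (borel (X * Y)%type) R.
Hypothesis cs : couplings mu nu sigma.

Lemma integral_coupling_fst (f : borel X -> \bar R) :
  measurable_fun [set: borel X] f -> (forall x, 0 <= f x) ->
  \int[sigma]_z f z.1 = \int[mu]_x f x.
Proof.
move=> mf f0; have [_ m1 _] := cs.
have := ge0_integral_pushforward (@borel_fst X Y) sigma measurableT mf (fun x _ => f0 x).
rewrite preimage_setT => <-; apply: eq_measure_integral => [|mphi A mA _].
  exact: borel_fst.
apply: etrans (m1 A mA); congr (sigma _).
by apply/seteqP; split => // z [].
Qed.

Lemma integral_coupling_snd (f : borel Y -> \bar R) :
  measurable_fun [set: borel Y] f -> (forall y, 0 <= f y) ->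
  \int[sigma]_z f z.2 = \int[nu]_y f y.
Proof.
move=> mf f0; have [_ _ m2] := cs.
have := ge0_integral_pushforward (@borel_snd X Y) sigma measurableT mf (fun x _ => f0 x).
rewrite preimage_setT => <-; apply: eq_measure_integral => [|mphi A mA _].
  exact: borel_snd.
apply: etrans (m2 A mA); congr (sigma _).
by apply/seteqP; split => // z [].
Qed.

Lemma coupling_setXC (A : set (borel X)) (B : set (borel Y)) :
  measurable A -> measurable B -> sigma (~` (A `*` B)) <= mu (~` A) + nu (~` B).
Proof.
move=> mA mB; have [_ m1 m2] := cs.
have mA' := measurableC mA; have mB' := measurableC mB.
rewrite -m1// -m2//.
have mAY : measurable (~` A `*` [set: Y] : set (borel (X * Y)%type)) by exact: borel_setXT.
have mXB : measurable ([set: X] `*` ~` B : set (borel (X * Y)%type)) by exact: borel_setTX.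
apply: le_trans (measureU2 sigma mAY mXB); apply: le_measure; rewrite ?inE.
- apply: measurableC; rewrite (_ : A `*` B = (A `*` setT) `&` (setT `*` B)).
    by apply: measurableI; [exact: borel_setXT|exact: borel_setTX].
  by apply/seteqP; split => z //= => [[]|[[? _] [_ ?]]].
- exact: measurableU.
- move=> z /= /not_andP[nA|nB]; [by left|by right].
Qed.

End couplings_theory.

End coupling_basics.

Lemma integral_lincomb (R : realType) d (T : measurableType d) (m : probability T R) (I : finType)
    (phi : I -> T -> R) (b : I -> R) :
  (forall i, measurable_fun [set: T] (phi i)) -> (forall i x, (0 <= phi i x <= 1)%R) ->
  (forall i, (0 <= b i)%R) ->
  \int[m]_x (\sum_i b i * phi i x)%:E =
    (\sum_i b i * fine (\int[m]_x (phi i x)%:E))%:E.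
Proof.
move=> mphi phi01 b0; have phi0 i x : (0 <= phi i x)%R by have /andP[] := phi01 i x.
under eq_integral do rewrite -sumEFin.
rewrite ge0_integral_sum//; last 2 first.
- by move=> i; apply/measurable_EFinP; exact: measurable_funM.
- by move=> i x _; rewrite lee_fin mulr_ge0.
rewrite -sumEFin; apply: eq_bigr => i _; rewrite EFinM integral_in_unit//.
under eq_integral do rewrite EFinM.
rewrite ge0_integralZl ?lee_fin//; first exact/measurable_EFinP.
by move=> x _; rewrite lee_fin.
Qed.

Lemma sum_integral_partition (R : realType) d (T : measurableType d)
    (m : probability T R) (I : finType) (phi : I -> T -> R) :
  (forall i, measurable_fun [set: T] (phi i)) -> (forall i x, (0 <= phi i x <= 1)%R) ->
  (forall x, (\sum_i phi i x = 1)%R) ->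
  (\sum_i fine (\int[m]_x (phi i x)%:E) = 1)%R.
Proof.
move=> mphi phi01 sphi; apply: EFin_inj.
transitivity (\int[m]_x (\sum_i 1 * phi i x)%:E).
  by rewrite integral_lincomb//; under [in RHS]eq_bigr do rewrite mul1r.
rewrite (eq_integral (cst 1)).
  by rewrite integral_cst// mul1e; exact: probability_setT.
by move=> x _; under eq_bigr do rewrite mul1r; rewrite sphi.
Qed.

Section partition_coupling.
Context (R : realType) (X Y : ptopologicalType).
Variables (mu : probability (borel X) R) (nu : probability (borel Y) R).
Hypotheses (hX : hausdorff_space X) (hY : hausdorff_space Y).
Hypothesis regX : regular_space X.
Hypotheses (radon_mu : radon_probability mu) (radon_nu : radon_probability nu).

(* The index [None] of the tensor coupling carries the normalised product of the
   residual marginals; [0 < m] keeps that normalisation meaningful, while a zero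
   [p i] or [q j] forces [s i j = 0] and the junk value of the quotient is harmless. *)
Lemma partition_coupling (I J : finType) (phi : I -> X -> R) (psi : J -> Y -> R)
    (s : I -> J -> R) (p : I -> R) (q : J -> R) (m : R) :
  (forall i, measurable_fun [set: borel X] (phi i)) ->
  (forall j, measurable_fun [set: borel Y] (psi j)) ->
  (forall i x, (0 <= phi i x)%R) -> (forall j y, (0 <= psi j y)%R) ->
  (forall x, (\sum_i phi i x = 1)%R) -> (forall y, (\sum_j psi j y = 1)%R) ->
  (forall i, p i = fine (\int[mu]_x (phi i x)%:E)) ->
  (forall j, q j = fine (\int[nu]_y (psi j y)%:E)) ->
  (forall i j, (0 <= s i j)%R) ->
  (forall i, (\sum_j s i j <= p i)%R) -> (forall j, (\sum_i s i j <= q j)%R) ->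
  (0 < m)%R -> (m = 1 - \sum_i \sum_j s i j)%R ->
  exists2 sigma, couplings mu nu sigma &
    forall (g : borel (X * Y)%type -> R) (D : set (borel (X * Y)%type)) (M : R)
        (c : I -> J -> R),
      measurable_fun [set: borel (X * Y)%type] g -> measurable D ->
      (forall z, (0 <= g z)%R) -> (forall i j, (0 <= c i j)%R) ->
      (forall z, (g z <= M)%R) ->
      (forall i j z, D z -> (0 < phi i z.1)%R -> (0 < psi j z.2)%R -> (g z <= c i j)%R) ->
      \int[sigma]_z (g z)%:E <=
        (\sum_i \sum_j c i j * s i j + M * m)%:E + M%:E * sigma (~` D).
Proof.
move=> mphi mpsi phi0 psi0 sphi spsi pE qE s0 sp sq m0 mE.
have phi01 i x : (0 <= phi i x <= 1)%R.
  by rewrite phi0/= -(sphi x) (bigD1 i)//= lerDl sumr_ge0.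
have psi01 j y : (0 <= psi j y <= 1)%R.
  by rewrite psi0/= -(spsi y) (bigD1 j)//= lerDl sumr_ge0.
have p0 i : (0 <= p i)%R by apply: le_trans (sp i); exact: sumr_ge0.
have q0 j : (0 <= q j)%R by apply: le_trans (sq j); exact: sumr_ge0.
have sp0 i j : p i = 0%R -> s i j = 0%R.
  move=> pi0; apply/eqP; rewrite eq_le s0 andbT -pi0 (le_trans _ (sp i))//.
  by rewrite (bigD1 j)//= lerDl sumr_ge0.
have sq0 i j : q j = 0%R -> s i j = 0%R.
  move=> qj0; apply/eqP; rewrite eq_le s0 andbT -qj0 (le_trans _ (sq j))//.
  by rewrite (bigD1 i)//= lerDl sumr_ge0.
(* The fraction of the i-th cell that the weights leave unassigned: [\sum_i a i * phi i] is the
   density of the residual of [mu], of total mass [m]; [b] is its analogue for [nu]. *)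
pose a i := (1 - (\sum_j s i j) / p i)%R.
pose b j := (1 - (\sum_i s i j) / q j)%R.
have a01 i : (0 <= a i <= 1)%R.
  rewrite /a subr_ge0 gerBl divr_ge0 ?sumr_ge0// andbT.
  have [->|pi0] := eqVneq (p i) 0%R; first by rewrite invr0 mulr0 ler01.
  by rewrite ler_pdivrMr ?mul1r// lt0r pi0 p0.
have b01 j : (0 <= b j <= 1)%R.
  rewrite /b subr_ge0 gerBl divr_ge0 ?sumr_ge0// andbT.
  have [->|qj0] := eqVneq (q j) 0%R; first by rewrite invr0 mulr0 ler01.
  by rewrite ler_pdivrMr ?mul1r// lt0r qj0 q0.
have ap i : (a i * p i = p i - \sum_j s i j)%R.
  have [pi0|pi0] := eqVneq (p i) 0%R; last by rewrite /a mulrBl mul1r divfK.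
  by rewrite pi0 mulr0 sub0r big1 ?oppr0// => j _; exact: sp0.
have bq j : (b j * q j = q j - \sum_i s i j)%R.
  have [qj0|qj0] := eqVneq (q j) 0%R; last by rewrite /b mulrBl mul1r divfK.
  by rewrite qj0 mulr0 sub0r big1 ?oppr0// => i _; exact: sq0.
(* The factors of cell (i, j) have masses [p i] and [q j], so this weight gives the cell mass
   [s i j]. Both residuals have mass [m], so the weight [m^-1] gives their product mass [m]. *)
pose w (o : option (I * J)) := if o is Some (i, j) then (s i j / (p i * q j))%R else m^-1%R.
pose u (o : option (I * J)) := if o is Some (i, j) then p i else m.
pose v (o : option (I * J)) := if o is Some (i, j) then q j else m.
pose F (o : option (I * J)) (x : X) :=
  if o is Some (i, j) then phi i x else (\sum_i a i * phi i x)%R.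
pose G (o : option (I * J)) (y : Y) :=
  if o is Some (i, j) then psi j y else (\sum_j b j * psi j y)%R.
have w0 o : (0 <= w o)%R.
  by case: o => [[i j]|] /=; rewrite ?divr_ge0 ?mulr_ge0// invr_ge0 ltW.
have mF o : measurable_fun [set: borel X] (F o).
  rewrite /F; case: o => [[i j]|] //=; apply: measurable_sum => i; exact: measurable_funM.
have mG o : measurable_fun [set: borel Y] (G o).
  rewrite /G; case: o => [[i j]|] //=; apply: measurable_sum => j; exact: measurable_funM.
have F0 o x : (0 <= F o x)%R.
  case: o => [[i j]|] //=; apply: sumr_ge0 => i _; rewrite mulr_ge0//.
  by have /andP[] := a01 i.
have G0 o y : (0 <= G o y)%R.
  case: o => [[i j]|] //=; apply: sumr_ge0 => j _; rewrite mulr_ge0//.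
  by have /andP[] := b01 j.
have F1 o x : (F o x <= 1)%R.
  case: o => [[i j]|] /=; first by have /andP[] := phi01 i x.
  rewrite -(sphi x); apply: ler_sum => i _; rewrite ler_piMl//.
  by have /andP[] := a01 i.
have G1 o y : (G o y <= 1)%R.
  case: o => [[i j]|] /=; first by have /andP[] := psi01 j y.
  rewrite -(spsi y); apply: ler_sum => j _; rewrite ler_piMl//.
  by have /andP[] := b01 j.
have int_F o : \int[mu]_x (F o x)%:E = (u o)%:E.
  case: o => [[i j]|] /=; first by rewrite pE integral_in_unit.
  rewrite integral_lincomb//; last by move=> i; have /andP[] := a01 i.
  under eq_bigr do rewrite -pE ap.
  by rewrite sumrB mE; under eq_bigr do rewrite pE; rewrite sum_integral_partition.
have int_G o : \int[nu]_y (G o y)%:E = (v o)%:E.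
  case: o => [[i j]|] /=; first by rewrite qE integral_in_unit.
  rewrite integral_lincomb//; last by move=> j; have /andP[] := b01 j.
  under eq_bigr do rewrite -qE bq.
  rewrite sumrB mE exchange_big/=; under eq_bigr do rewrite qE; rewrite sum_integral_partition//.
have pair_sum (H : I -> J -> R) : (\sum_(k : I * J) H k.1 k.2 = \sum_i \sum_j H i j)%R.
  by rewrite pair_bigA.
have wv i j : (s i j / (p i * q j) * q j = s i j / p i)%R.
  have [qj0|qj0] := eqVneq (q j) 0%R; first by rewrite sq0// !mul0r.
  by rewrite invfM mulrA mulfVK.
have wu i j : (s i j / (p i * q j) * p i = s i j / q j)%R.
  have [pi0|pi0] := eqVneq (p i) 0%R; first by rewrite sp0// !mul0r.
  by rewrite invfM [((p i)^-1 * _)%R]mulrC mulrA mulfVK.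
(* The cells (i, j), summed over j, contribute the assigned fraction of [phi i] and the residual
   contributes [a i], together [phi i]. *)
have sumF x : (\sum_o w o * v o * F o x = 1)%R.
  rewrite big_option/= mulVf ?gt_eqF// mul1r.
  rewrite (eq_bigr (fun k : I * J => s k.1 k.2 / p k.1 * phi k.1 x)%R); last first.
    by move=> [i j] _ /=; rewrite wv.
  rewrite (pair_sum (fun i j => s i j / p i * phi i x)%R) -big_split/= -(sphi x).
  by apply: eq_bigr => i _; rewrite -!mulr_suml -mulrDl /a subrK mul1r.
have sumG y : (\sum_o w o * u o * G o y = 1)%R.
  rewrite big_option/= mulVf ?gt_eqF// mul1r.
  rewrite (eq_bigr (fun k : I * J => s k.1 k.2 / q k.2 * psi k.2 y)%R); last first.
    by move=> [i j] _ /=; rewrite wu.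
  rewrite (pair_sum (fun i j => s i j / q j * psi j y)%R) exchange_big -big_split/= -(spsi y).
  by apply: eq_bigr => j _; rewrite -!mulr_suml -mulrDl /b subrK mul1r.
exists (tensor_coupling mu hY radon_nu w0 mF mG F0 G0 int_G sumF).
  exact: (tensor_couplingP hX hY regX radon_mu radon_nu w0 mF mG F0 F1 G0 G1 int_F).
move=> g D M c mg mD g0 c0 gM gc.
have M0 : (0 <= M)%R by rewrite (le_trans (g0 point)).
(* On the residual product nothing better than the global bound is known; this produces the term
   [M * m]. *)
pose c' (o : option (I * J)) := if o is Some (i, j) then c i j else M.
apply: (@le_trans _ _ ((\sum_o c' o * w o * u o * v o)%:E +
    M%:E * tensor_coupling mu hY radon_nu w0 mF mG F0 G0 int_G sumF (~` D))).
  apply: (integral_tensor_coupling_le hY radon_nu w0 mF mG F0 G0 int_F int_G sumF) => //.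
    by case=> [[i j]|] /=.
  by case=> [[i j]|] //= z Dz Fz Gz; exact: gc.
rewrite leeD2r// lee_fin big_option/= addrC mulfVK ?gt_eqF// lerD2r.
rewrite -(pair_sum (fun i j => c i j * s i j)%R).
apply: ler_sum => -[i j] _ /=.
rewrite -!mulrA ler_wpM2l// mulrA mulrA wu.
have [qj0|qj0] := eqVneq (q j) 0%R; first by rewrite sq0// !mul0r.
by rewrite mulfVK.
Qed.

End partition_coupling.

Section transfer.
Context (R : realType) (X Y : ptopologicalType).
Hypotheses (hX : hausdorff_space X) (hY : hausdorff_space Y).
Hypothesis regX : regular_space X.

(** Both costs are compared with the same cell constants, each at the price [e]; this is the 2 e.
    The 7 d M collects 2 d M for the part of [sigma] outside K x L, 2 d M for that of [sigma'], and
    3 d M for the residual mass. *)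
Lemma transfer_coupling (mu mu' : probability (borel X) R)
    (nu nu' : probability (borel Y) R) (sigma : probability (borel (X * Y)%type) R)
    (I J : finType) (phi : I -> X -> R) (psi : J -> Y -> R) (c : I -> J -> R)
    (K : set X) (L : set Y) (g g' : borel (X * Y)%type -> R) (M e d : R) :
  radon_probability mu' -> radon_probability nu' -> couplings mu nu sigma ->
  (forall i, continuous (phi i)) -> (forall j, continuous (psi j)) ->
  (forall i x, (0 <= phi i x)%R) -> (forall j y, (0 <= psi j y)%R) ->
  (forall x, (\sum_i phi i x = 1)%R) -> (forall y, (\sum_j psi j y = 1)%R) ->
  (forall i j, (0 <= c i j <= M)%R) ->
  compact K -> compact L ->
  measurable_fun [set: borel (X * Y)%type] g ->
  measurable_fun [set: borel (X * Y)%type] g' ->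
  (forall z, (0 <= g z)%R) -> (forall z, (0 <= g' z <= M)%R) ->
  (0 <= e)%R -> (0 < d < 1)%R ->
  (forall i j x y, K x -> L y -> (0 < phi i x)%R -> (0 < psi j y)%R ->
    (c i j <= g (x, y) + e)%R) ->
  (forall i j x y, K x -> L y -> (0 < phi i x)%R -> (0 < psi j y)%R ->
    (g' (x, y) <= c i j + e)%R) ->
  (\sum_i `|fine (\int[mu]_x (phi i x)%:E) - fine (\int[mu']_x (phi i x)%:E)| <= d)%R ->
  (\sum_j `|fine (\int[nu]_y (psi j y)%:E) - fine (\int[nu']_y (psi j y)%:E)| <= d)%R ->
  mu (~` K) <= d%:E -> mu' (~` K) <= d%:E -> nu (~` L) <= d%:E -> nu' (~` L) <= d%:E ->
  exists2 sigma', couplings mu' nu' sigma' &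
    \int[sigma']_z (g' z)%:E <= \int[sigma]_z (g z)%:E + (2 * e + 7 * d * M)%:E.
Proof.
move=> rmu' rnu' csig cphi cpsi phi0 psi0 sphi spsi cM cK cL mg mg' g0 g'M e0 d01 cg g'c.
move=> dphi dpsi muK mu'K nuL nu'L; have /andP[d0 d1] := d01.
have M0 : (0 <= M)%R by have /andP[/le_trans] := g'M point; apply.
have mphi i : measurable_fun [set: borel X] (phi i) by exact: continuous_borel_real.
have mpsi j : measurable_fun [set: borel Y] (psi j) by exact: continuous_borel_real.
have phi01 i x : (0 <= phi i x <= 1)%R.
  by rewrite phi0/= -(sphi x) (bigD1 i)//= lerDl sumr_ge0.
have psi01 j y : (0 <= psi j y <= 1)%R.
  by rewrite psi0/= -(spsi y) (bigD1 j)//= lerDl sumr_ge0.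
have c0 i j : (0 <= c i j)%R by have /andP[] := cM i j.
pose D : set (borel (X * Y)%type) := K `*` L.
have mK : measurable (K : set (borel X)) by exact: borel_compact.
have mL : measurable (L : set (borel Y)) by exact: borel_compact.
have mD : measurable D.
  by apply: borel_compact; [exact: hausdorff_prod|exact: compact_setX].
pose t i j (z : borel (X * Y)%type) := (phi i z.1 * psi j z.2)%R.
have mt i j : measurable_fun [set: borel (X * Y)%type] (t i j).
  exact: (measurable_tensor (mphi i) (mpsi j)).
have t01 i j z : (0 <= t i j z <= 1)%R.
  rewrite mulr_ge0//= mulr_ile1//.
    by have /andP[] := phi01 i z.1.
  by have /andP[] := psi01 j z.2.
have t0 i j z : (0 <= t i j z)%R by have /andP[] := t01 i j z.
(* All that the construction retains of [sigma]. Its row and column sums are the cell masses of [mu]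
   and [nu]. *)
pose s i j := fine (\int[sigma]_z (t i j z)%:E).
have s0 i j : (0 <= s i j)%R.
  by apply: fine_ge0; apply: integral_ge0 => z _; rewrite lee_fin.
have srow i : (\sum_j s i j = fine (\int[mu]_x (phi i x)%:E))%R.
  apply: EFin_inj; rewrite integral_in_unit//.
  rewrite -(integral_coupling_fst csig)//; last 2 first.
  - exact/measurable_EFinP.
  - by move=> x; rewrite lee_fin.
  under eq_bigr do rewrite -(mul1r (s _ _)).
  rewrite -integral_lincomb//; apply: eq_integral => z _.
  by under eq_bigr do rewrite mul1r; rewrite -mulr_sumr spsi mulr1.
have scol j : (\sum_i s i j = fine (\int[nu]_y (psi j y)%:E))%R.
  apply: EFin_inj; rewrite integral_in_unit//.
  rewrite -(integral_coupling_snd csig)//; last 2 first.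
  - exact/measurable_EFinP.
  - by move=> x; rewrite lee_fin.
  under eq_bigr do rewrite -(mul1r (s _ _)).
  rewrite -(integral_lincomb _ (mt^~ j))//; apply: eq_integral => z _.
  by under eq_bigr do rewrite mul1r; rewrite -mulr_suml sphi mul1r.
have s1 : (\sum_i \sum_j s i j = 1)%R.
  by under eq_bigr do rewrite srow; exact: sum_integral_partition.
have tsum z : (\sum_i \sum_j t i j z = 1)%R.
  by under eq_bigr do rewrite -mulr_sumr spsi mulr1.
have p'0 i : (0 <= fine (\int[mu']_x (phi i x)%:E))%R.
  by apply: fine_ge0; apply: integral_ge0 => z _; rewrite lee_fin.
have q'0 j : (0 <= fine (\int[nu']_y (psi j y)%:E))%R.
  by apply: fine_ge0; apply: integral_ge0 => z _; rewrite lee_fin.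
have [s' [s's s'row s'col /andP[ms' s'm]]] := shrink_weights d01 s0 p'0 q'0 s1.
set m := (1 - \sum_i \sum_j s' i j)%R in ms' s'm.
(* One [d] from the deliberate shrinking and one from the discrepancy of each pair of marginals. *)
have m3 : (m <= 3 * d)%R.
  apply: le_trans s'm _; under eq_bigr do rewrite srow.
  under [X in (_ + X)%R]eq_bigr do rewrite scol.
  by lra.
have s'0 i j : (0 <= s' i j)%R by have /andP[] := s's i j.
have [sigma' csig' sigma'P] := partition_coupling hX hY regX rmu' rnu' mphi mpsi
  phi0 psi0 sphi spsi (fun=> erefl) (fun=> erefl) s'0 s'row s'col (lt_le_trans d0 ms') erefl.
exists sigma' => //.
have sigma'D : M%:E * sigma' (~` D) <= (M * (2 * d))%:E.
  rewrite EFinM lee_wpmul2l ?lee_fin//.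
  apply: le_trans (coupling_setXC csig' mK mL) _.
  by rewrite mulrDl mul1r EFinD leeD.
have sigmaD : M%:E * sigma (~` D) <= (M * (2 * d))%:E.
  rewrite EFinM lee_wpmul2l ?lee_fin//.
  apply: le_trans (coupling_setXC csig mK mL) _.
  by rewrite mulrDl mul1r EFinD leeD.
(* The left side integrates the average of the [c i j] with weights [t i j z], which sum to 1; this
   average is at most [g z + e] on [D] and at most [M] elsewhere. *)
have source : (\sum_i \sum_j c i j * s i j)%:E <=
    \int[sigma]_z (g z)%:E + (e + M * (2 * d))%:E.
  have mI : measurable_fun [set: borel (X * Y)%type] (fun z => (M * \1_(~` D) z)%:E).
    apply/measurable_EFinP; apply: measurable_funM => //.
    by apply: measurable_indic; exact: measurableC.
  have I0 z : 0 <= (M * \1_(~` D) z)%:E by rewrite lee_fin mulr_ge0.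
  apply: (@le_trans _ _ (\int[sigma]_z ((g z)%:E + (e%:E + (M * \1_(~` D) z)%:E)))).
    rewrite pair_bigA -(integral_lincomb _ (fun k : I * J => mt k.1 k.2))//.
    apply: ge0_le_integral => //.
    - by move=> z _; rewrite lee_fin sumr_ge0// => k _; rewrite mulr_ge0.
    - by apply/measurable_EFinP; apply: measurable_sum => k; exact: measurable_funM.
    - apply: emeasurable_funD; first exact/measurable_EFinP.
      exact: emeasurable_funD.
    move=> z _; rewrite -(pair_bigA _ (fun i j => c i j * t i j z)%R)/= -!EFinD lee_fin.
    rewrite indicE in_setC; have [/set_mem Dz|nDz] /= := boolP (z \in D); last first.
      rewrite mulr1 (@le_trans _ _ (\sum_i \sum_j M * t i j z)%R)//.
        apply: ler_sum => i _; apply: ler_sum => j _; rewrite ler_wpM2r//.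
        by have /andP[] := cM i j.
      under eq_bigr do rewrite -mulr_sumr.
      by rewrite -mulr_sumr tsum mulr1; have := g0 z; move: e0; lra.
    rewrite mulr0 addr0 -[leRHS]mulr1 -(tsum z) mulr_sumr.
    apply: ler_sum => i _; rewrite mulr_sumr; apply: ler_sum => j _.
    have [phiz|phiz] := eqVneq (phi i z.1) 0%R; first by rewrite /t phiz mul0r !mulr0.
    have [psiz|psiz] := eqVneq (psi j z.2) 0%R; first by rewrite /t psiz !mulr0.
    rewrite ler_wpM2r//; case: z Dz phiz psiz => x y [/= Kx Ly] phix psiy.
    by apply: cg => //; rewrite lt0r ?phix ?psiy/=.
  have mgE : measurable_fun [set: borel (X * Y)%type] (fun z => (g z)%:E).
    exact/measurable_EFinP.
  have mDE : measurable_fun [set: borel (X * Y)%type] (fun z => (\1_(~` D) z)%:E : \bar R).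
    by apply/measurable_EFinP; apply: measurable_indic; exact: measurableC.
  rewrite ge0_integralD//; [|by move=> z _; rewrite lee_fin|
    by move=> z _; rewrite adde_ge0|exact: emeasurable_funD].
  rewrite leeD2l// ge0_integralD// integral_cst//= [sigma setT]probability_setT mule1.
  rewrite EFinD leeD2l//; apply: le_trans sigmaD.
  under eq_integral do rewrite EFinM.
  rewrite ge0_integralZl ?lee_fin//.
  by rewrite integral_indic// ?setIT//; exact: measurableC.
apply: (@le_trans _ _ ((\sum_i \sum_j (c i j + e) * s' i j + M * m)%:E +
    M%:E * sigma' (~` D))).
  apply: sigma'P => //.
  - by move=> z; have /andP[] := g'M z.
  - by move=> i j; rewrite addr_ge0.
  - by move=> z; have /andP[] := g'M z.
  - by move=> i j [x y] [/= Kx Ly]; exact: g'c.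
apply: (@le_trans _ _ ((\sum_i \sum_j c i j * s i j)%:E + (e + M * (5 * d))%:E)).
  apply: le_trans (leeD2l _ sigma'D) _; rewrite -!EFinD lee_fin.
  have le1 : (\sum_i \sum_j (c i j + e) * s' i j <= \sum_i \sum_j c i j * s i j + e)%R.
    rewrite -[X in (_ <= _ + X)%R]mulr1 -s1 mulr_sumr -big_split/=.
    apply: ler_sum => i _; rewrite mulr_sumr -big_split/=; apply: ler_sum => j _.
    by rewrite -mulrDl ler_wpM2l ?addr_ge0//; have /andP[] := s's i j.
  have le2 : (M * m <= M * (3 * d))%R by rewrite ler_wpM2l.
  have -> : (M * (5 * d) = M * (3 * d) + M * (2 * d))%R by ring.
  lra.
rewrite (_ : (2 * e + _) = (e + M * (2 * d)) + (e + M * (5 * d)))%R; last by ring.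
by rewrite [in leRHS]EFinD addeA leeD2r.
Qed.

End transfer.

Lemma near_uniform_compact (R : realType) (T : ptopologicalType)
    (f_ : nat -> T -> R) (f : T -> R) (K : set T) (e : R) :
  {family compact, f_ @ \oo --> f} -> compact K -> (0 < e)%R ->
  \forall n \near \oo, forall z, K z -> (`|f_ n z - f z| < e)%R.
Proof.
move=> /fam_cvgP cvgf cK e0.
apply: (cvgf K cK [set h | forall z, K z -> (`|h z - f z| < e)%R]).
apply/uniform_nbhs; exists [set xy | ball xy.1 e xy.2]; split.
  exact: (entourage_ball _ (PosNum e0)).
by move=> h /= hE z Kz; rewrite distrC; exact: hE.
Qed.

(** * Stability for bounded costs *)

Section bounded_stability.
Context (R : realType) (X Y : ptopologicalType).
Hypotheses (hX : hausdorff_space X) (hY : hausdorff_space Y).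
Hypothesis regX : regular_space X.

Lemma weak_cvg_partition (T : ptopologicalType) (m_ : nat -> probability (borel T) R)
    (m : probability (borel T) R) (I : finType) (phi : I -> T -> R) (d : R) :
  weakly_converges m_ m -> (forall i, continuous (phi i)) ->
  (forall i x, (0 <= phi i x)%R) -> (forall x, (\sum_i phi i x = 1)%R) -> (0 < d)%R ->
  \forall n \near \oo, (\sum_i
    `|fine (\int[m]_x (phi i x)%:E) - fine (\int[m_ n]_x (phi i x)%:E)| < d)%R.
Proof.
move=> wm cphi phi0 sphi d0.
have phi01 i x : (0 <= phi i x <= 1)%R.
  by rewrite phi0/= -(sphi x) (bigD1 i)//= lerDl sumr_ge0.
have mphi i : measurable_fun [set: borel T] (phi i) by exact: continuous_borel_real.
have cvg_i i : fine (\int[m_ n]_x (phi i x)%:E) @[n --> \oo] --> fine (\int[m]_x (phi i x)%:E).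
  apply: fine_cvg; rewrite integral_in_unit//; apply: wm => //.
  exists 1%R; split => // r r1 x _; rewrite /= ger0_norm//.
  by rewrite (le_trans _ (ltW r1))//; have /andP[] := phi01 i x.
have cvg_sum0 (s : seq I) : (\sum_(i <- s)
    `|fine (\int[m]_x (phi i x)%:E) - fine (\int[m_ n]_x (phi i x)%:E)|)%R @[n --> \oo]
    --> (0%R : R).
  elim: s => [|i s IH]; first by under eq_fun do rewrite big_nil; exact: cvg_cst.
  under eq_fun do rewrite big_cons.
  have cvgi : `|fine (\int[m]_x (phi i x)%:E) - fine (\int[m_ n]_x (phi i x)%:E)|%R
      @[n --> \oo] --> (0%R : R).
    rewrite -(normr0 R) -(subrr (fine (\int[m]_x (phi i x)%:E))).
    by apply: cvg_norm; apply: cvgB; [exact: cvg_cst|exact: cvg_i].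
  by have := cvgD cvgi IH; rewrite addr0; apply.
have /cvgr0Pnorm_lt/(_ d d0) := cvg_sum0 (index_enum I).
by apply: filterS => n; rewrite ger0_norm// sumr_ge0.
Qed.

Lemma tight_compact (T : ptopologicalType) (m_ : nat -> probability (borel T) R)
    (m : probability (borel T) R) (d : R) :
  hausdorff_space T -> radon_probability m -> uniformly_tight (range m_) -> (0 < d)%R ->
  exists K : set T, [/\ compact K, m (~` K) <= d%:E & forall n, m_ n (~` K) <= d%:E].
Proof.
move=> hT rm tm d0.
have [K1 cK1 K1d] := tm d d0.
have [K2 [cK2 _ K2d]] := rm setT measurableT _ d0.
have mK1 : measurable (K1 : set (borel T)) by exact: borel_compact.
have mK2 : measurable (K2 : set (borel T)) by exact: borel_compact.
exists (K1 `|` K2); split; first exact: compact_setU.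
- apply: le_trans (ltW K2d); rewrite setTD; apply: le_measure; rewrite ?inE.
  + by apply: measurableC; exact: measurableU.
  + exact: measurableC.
  + by apply: subsetC => x; right.
- move=> n; apply: (@le_trans _ _ (m_ n (~` K1))); last by apply: ltW; apply: K1d; exists n.
  apply: le_measure; rewrite ?inE.
  + by apply: measurableC; exact: measurableU.
  + exact: measurableC.
  + by apply: subsetC => x; left.
Qed.

Variables (mu_ : nat -> probability (borel X) R) (mu : probability (borel X) R).
Variables (nu_ : nat -> probability (borel Y) R) (nu : probability (borel Y) R).
Hypotheses (radon_mu_ : forall n, radon_probability (mu_ n)).
Hypotheses (radon_nu_ : forall n, radon_probability (nu_ n)).
Hypotheses (radon_mu : radon_probability mu) (radon_nu : radon_probability nu).
Hypotheses (cvg_mu : weakly_converges mu_ mu) (cvg_nu : weakly_converges nu_ nu).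
Hypotheses (tight_mu : uniformly_tight (range mu_)).
Hypotheses (tight_nu : uniformly_tight (range nu_)).

(** The index is chosen before [sigma]: closeness of the marginals is tested only on finitely many
    partition functions, fixed in advance. This uniformity is what allows infima to be compared. *)
Lemma bounded_stability (f_ : nat -> X * Y -> R) (f : X * Y -> R) (M e : R) :
  (forall n, continuous (f_ n)) -> measurable_fun [set: borel (X * Y)%type] f ->
  (forall n z, (0 <= f_ n z <= M)%R) -> (forall z, (0 <= f z <= M)%R) ->
  (forall K : set (X * Y), compact K -> forall r : R, (0 < r)%R ->
    \forall n \near \oo, forall z, K z -> (`|f_ n z - f z| < r)%R) ->
  (0 < e)%R ->
  \forall n \near \oo,
    (forall sigma, couplings mu nu sigma ->
      exists2 sigma', couplings (mu_ n) (nu_ n) sigma' &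
        \int[sigma']_z (f_ n z)%:E <= \int[sigma]_z (f z)%:E + e%:E) /\
    (forall sigma, couplings (mu_ n) (nu_ n) sigma ->
      exists2 sigma', couplings mu nu sigma' &
        \int[sigma']_z (f z)%:E <= \int[sigma]_z (f_ n z)%:E + e%:E).
Proof.
move=> cf mf f_M fM cvgf e0.
have M0 : (0 <= M)%R by have /andP[/le_trans] := fM point; apply.
(* Each summand of the transfer error 2 (3 r) + 7 d M is at most [e / 2], and [d] stays below 1. *)
pose r := (e / 12)%R; pose d := Num.min (1 / 2)%R (e / (14 * (M + 1)))%R.
have r0 : (0 < r)%R by rewrite divr_gt0.
have M10 : (0 < M + 1)%R by rewrite ltr_wpDl.
have d0 : (0 < d)%R by rewrite lt_min !divr_gt0// mulr_gt0.
have d1 : (0 < d < 1)%R by rewrite d0 gt_min; apply/orP; left; lra.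
have rd : (2 * (3 * r) + 7 * d * M <= e)%R.
  have : (d * (14 * (M + 1)) <= e)%R by rewrite -ler_pdivlMr ?mulr_gt0// ge_min lexx orbT.
  rewrite /r; lra.
have [K [cK muK mu_K]] := tight_compact hX radon_mu tight_mu d0.
have [L [cL nuL nu_L]] := tight_compact hY radon_nu tight_nu d0.
have cvgKL := cvgf _ (compact_setX cK cL) _ r0.
(* The limit [f] is only Borel, so the partition is built for the continuous [f_ N]. Passing to [f]
   raises the oscillation bound from [r] to [2 * r], and from [f] to [f_ n] to [3 * r]. *)
have [N _ /(_ N (leqnn N)) /= fN] := cvgKL.
have [I [J [phi [psi [c [cphi cpsi [[phi0 psi0 sphi spsi] [cM oscF]]]]]]]] :=
  oscillation_partition (cf N) (f_M N) r0 cK cL.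
have osc i j x y : K x -> L y -> (0 < phi i x)%R -> (0 < psi j y)%R ->
    (`|f (x, y) - c i j| <= 2 * r)%R.
  move=> Kx Ly px py; have := oscF i j x y Kx Ly px py; have := fN (x, y) (conj Kx Ly).
  by rewrite ltr_norml !ler_norml => /andP[? ?] /andP[? ?]; apply/andP; split; lra.
near=> n.
have fn : forall z, (K `*` L) z -> (`|f_ n z - f z| < r)%R by near: n.
have osc_n i j x y : K x -> L y -> (0 < phi i x)%R -> (0 < psi j y)%R ->
    (`|f_ n (x, y) - c i j| <= 3 * r)%R.
  move=> Kx Ly px py; have := osc i j x y Kx Ly px py; have := fn (x, y) (conj Kx Ly).
  by rewrite ltr_norml !ler_norml => /andP[? ?] /andP[? ?]; apply/andP; split; lra.
have dphi : (\sum_i `|fine (\int[mu]_x (phi i x)%:E) -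
    fine (\int[mu_ n]_x (phi i x)%:E)| < d)%R.
  by near: n; exact: weak_cvg_partition.
have dpsi : (\sum_j `|fine (\int[nu]_y (psi j y)%:E) -
    fine (\int[nu_ n]_y (psi j y)%:E)| < d)%R.
  by near: n; exact: weak_cvg_partition.
have mfn : measurable_fun [set: borel (X * Y)%type] (f_ n) by exact: continuous_borel_real.
have r30 : (0 <= 3 * r)%R by rewrite mulr_ge0// ltW.
split => sigma csigma.
- have [sigma' csigma' le] : exists2 sigma', couplings (mu_ n) (nu_ n) sigma' &
      \int[sigma']_z (f_ n z)%:E <= \int[sigma]_z (f z)%:E + (2 * (3 * r) + 7 * d * M)%:E.
    apply: (@transfer_coupling R X Y hX hY regX mu (mu_ n) nu (nu_ n)
      sigma I J phi psi c K L) => //.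
    - by move=> z; have /andP[] := fM z.
    - move=> i j x y Kx Ly px py; have := osc i j x y Kx Ly px py.
      by rewrite ler_norml => /andP[? ?]; lra.
    - move=> i j x y Kx Ly px py; have := osc_n i j x y Kx Ly px py.
      by rewrite ler_norml => /andP[? ?]; lra.
    - exact: ltW.
    - exact: ltW.
  exists sigma' => //; apply: le_trans le _.
  by rewrite leeD2l// lee_fin.
- have [sigma' csigma' le] : exists2 sigma', couplings mu nu sigma' &
      \int[sigma']_z (f z)%:E <= \int[sigma]_z (f_ n z)%:E + (2 * (3 * r) + 7 * d * M)%:E.
    apply: (@transfer_coupling R X Y hX hY regX (mu_ n) mu (nu_ n) nu
      sigma I J phi psi c K L) => //.
    - by move=> z; have /andP[] := f_M n z.
    - move=> i j x y Kx Ly px py; have := osc_n i j x y Kx Ly px py.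
      by rewrite ler_norml => /andP[? ?]; lra.
    - move=> i j x y Kx Ly px py; have := osc i j x y Kx Ly px py.
      by rewrite ler_norml => /andP[? ?]; lra.
    - by under eq_bigr do rewrite distrC; exact: ltW.
    - by under eq_bigr do rewrite distrC; exact: ltW.
  exists sigma' => //; apply: le_trans le _.
  by rewrite leeD2l// lee_fin.
Unshelve. all: by end_near.
Qed.

End bounded_stability.

(** * Unbounded costs *)

(** The additive form of both estimates also covers an infinite limit: [l <= u n + e%:E] then forces
    [u n] to be infinite for large [n]. *)
Lemma cvge_two_sided (R : realType) (u : nat -> \bar R) (l : \bar R) :
  0 <= l ->
  (forall e : R, (0 < e)%R -> \forall n \near \oo, u n <= l + e%:E /\ l <= u n + e%:E) ->
  u @ \oo --> l.
Proof.
move=> l0 ul; case: l l0 ul => [l| |]// _ ul; last first.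
  apply: cvg_near_cst; apply: filterS (ul _ ltr01) => n [_].
  by rewrite leye_eq; case: (u n).
apply/fine_cvgP; split.
  apply: filterS (ul _ ltr01) => n [].
  by case: (u n).
apply/cvgrPdist_le => e e0; apply: filterS (ul _ e0) => n [] /=.
case: (u n) => [x| |]//=; rewrite -!EFinD !lee_fin => h1 h2.
by rewrite ler_norml; apply/andP; split; lra.
Qed.

Lemma ge0_integral_sub_cst d (T : measurableType d) (R : realType)
    (m : probability T R) (f : T -> R) (M : R) :
  measurable_fun [set: T] f -> (forall x, (0 <= f x <= M)%R) ->
  \int[m]_x (M - f x)%:E = M%:E - \int[m]_x (f x)%:E.
Proof.
move=> mf fM.
have f0 x : (0 <= f x)%R by have /andP[] := fM x.
have Mf0 x : (0 <= M - f x)%R by rewrite subr_ge0; have /andP[] := fM x.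
have sumE : \int[m]_x (M - f x)%:E + \int[m]_x (f x)%:E = M%:E.
  rewrite -ge0_integralD//.
  - rewrite (eq_integral (cst M%:E)) => [|x _]; last by rewrite -EFinD subrK.
    rewrite integral_cst//; transitivity (M%:E * 1); last by rewrite mule1.
    congr (_ * _); exact: probability_setT.
  - by move=> x _; rewrite lee_fin.
  - by apply/measurable_EFinP; exact: measurable_funB.
  - by move=> x _; rewrite lee_fin.
  - exact/measurable_EFinP.
have I0 : 0 <= \int[m]_x (f x)%:E by apply: integral_ge0 => x _; rewrite lee_fin.
have J0 : 0 <= \int[m]_x (M - f x)%:E by apply: integral_ge0 => x _; rewrite lee_fin.
move: I0 J0 sumE; case: (integral _ _ _) => [b| |]//; case: (integral _ _ _) => [a| |]//.
by move=> _ _ <-; rewrite -EFinB addrK.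
Qed.

Lemma integral_truncation d (T : measurableType d) (R : realType)
    (m : probability T R) (f : T -> R) (r : R) :
  measurable_fun [set: T] f -> (forall x, (0 <= f x)%R) -> (0 <= r)%R ->
  \int[m]_x (f x)%:E =
    \int[m]_x (Num.min (f x) r)%:E + \int[m]_x (Num.max (f x - r) 0)%:E.
Proof.
move=> mf f0 r0; rewrite -ge0_integralD//.
- apply: eq_integral => x _; rewrite -EFinD; congr EFin.
  by case: (leP (f x) r) => fr; case: (leP (f x - r)%R 0%R) => fr'; move: fr fr'; lra.
- by move=> x _; rewrite lee_fin le_min f0.
- by apply/measurable_EFinP; exact: measurable_minr.
- by move=> x _; rewrite lee_fin le_max lexx orbT.
- by apply/measurable_EFinP; apply: measurable_maxr => //; exact: measurable_funB.
Qed.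

Lemma lip1_minr (R : realDomainType) (r s t : R) :
  (`|Num.min s r - Num.min t r| <= `|s - t|)%R.
Proof.
case: (leP s r) => sr; case: (leP t r) => tr; rewrite ?subrr// ler_norml;
  case: (ler0P (s - t)%R) => st; lra.
Qed.

Lemma lip1_maxr (R : realDomainType) (r s t : R) :
  (`|Num.max s r - Num.max t r| <= `|s - t|)%R.
Proof.
case: (leP s r) => sr; case: (leP t r) => tr; rewrite ?subrr// ler_norml;
  case: (ler0P (s - t)%R) => st; lra.
Qed.

Lemma lip1_continuous (R : realType) (theta : R -> R) :
  (forall s t, (`|theta s - theta t| <= `|s - t|)%R) -> continuous theta.
Proof.
move=> lip t; apply/cvgrPdist_lt => e e0; near=> s.
apply: le_lt_trans (lip t s) _; near: s.
by apply: cvgr_dist_lt => //; exact: cvg_id.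
Unshelve. all: by end_near.
Qed.

Lemma measurable_superlevel d (T : measurableType d) (R : realType) (f : T -> R) (r : R) :
  measurable_fun [set: T] f -> measurable [set x | (r <= f x)%R].
Proof.
move=> mf; rewrite (_ : [set x | _] = setT `&` f @^-1` `[r, +oo[%classic).
  exact: mf.
by apply/seteqP; split => x /=; rewrite in_itv/= andbT => // -[].
Qed.

(** Where a >= r, the exponent 1 - p being negative, a = a^(1-p) a^p <= r^(1-p) a^p. *)
Lemma integral_superlevel_Lnorm d (T : measurableType d) (R : realType)
    (m : probability T R)
    (a : T -> R) (p r C : R) :
  measurable_fun [set: T] a -> (forall x, (0 <= a x)%R) -> (1 < p)%R -> (0 < r)%R ->
  'N[m]_p%:E[EFin \o a] <= C%:E ->
  \int[m]_(x in [set x | (r <= a x)%R]) (a x)%:E <= (r `^ (1 - p) * C `^ p)%:E.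
Proof.
move=> ma a0 p1 r0 NC.
have p0 : (0 < p)%R by exact: lt_trans p1.
have mS := measurable_superlevel r ma.
have map : measurable_fun [set: T] (fun x => (a x `^ p)%R).
  exact: (measurableT_comp (measurable_powR p) ma).
have ap : \int[m]_x (a x `^ p)%:E <= (C `^ p)%:E.
  have N0 := Lnorm_ge0 m p%:E (EFin \o a).
  rewrite -poweR_EFin; apply: (@le_trans _ _ ('N[m]_p%:E[EFin \o a] `^ p)).
    rewrite poweR_Lnorm ?gt_eqF// le_eqVlt; apply/orP; left; apply/eqP.
    by apply: eq_integral => x _; rewrite /= ger0_norm.
  apply: gt0_ler_poweR => //; first exact: ltW.
    by rewrite in_itv/= N0 leey.
  by rewrite in_itv/= (le_trans N0 NC) leey.
apply: (@le_trans _ _ (\int[m]_(x in [set x | (r <= a x)%R]) ((r `^ (1 - p))%:E * (a x `^ p)%:E))).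
  apply: ge0_le_integral => //.
  - by move=> x _; rewrite lee_fin.
  - by apply: measurable_funTS; exact/measurable_EFinP.
  - apply: measurable_funeM; apply: measurable_funTS; exact/measurable_EFinP.
  - move=> x /= ra; rewrite -EFinM lee_fin.
    have ax0 : (0 < a x)%R by exact: lt_le_trans ra.
    rewrite -[leLHS](powRr1 (a0 x)) -[X in (_ `^ X)%R](subrK p) powRD; last first.
      by apply/implyP => _; rewrite gt_eqF.
    rewrite ler_wpM2r ?powR_ge0//.
    rewrite -opprB !powRN lef_pV2 ?posrE ?powR_gt0//.
    by rewrite ge0_ler_powR ?nnegrE// ?(ltW r0)// subr_ge0 ltW.
rewrite ge0_integralZl ?lee_fin ?powR_ge0//.
  rewrite EFinM lee_wpmul2l ?lee_fin ?powR_ge0//; apply: le_trans ap.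
  apply: ge0_subset_integral => //; first exact/measurable_EFinP.
  by move=> x _; rewrite lee_fin powR_ge0.
- by apply: measurable_funTS; exact/measurable_EFinP.
- by move=> x _; rewrite lee_fin powR_ge0.
Qed.

Section stability.
Context (R : realType) (X Y : ptopologicalType).
Hypotheses (hX : hausdorff_space X) (hY : hausdorff_space Y).
Hypothesis regX : regular_space X.
Variables (mu_ : nat -> probability (borel X) R) (mu : probability (borel X) R).
Variables (nu_ : nat -> probability (borel Y) R) (nu : probability (borel Y) R).
Hypotheses (radon_mu_ : forall n, radon_probability (mu_ n)).
Hypotheses (radon_nu_ : forall n, radon_probability (nu_ n)).
Hypotheses (radon_mu : radon_probability mu) (radon_nu : radon_probability nu).
Hypotheses (cvg_mu : weakly_converges mu_ mu) (cvg_nu : weakly_converges nu_ nu).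
Hypotheses (tight_mu : uniformly_tight (range mu_)).
Hypotheses (tight_nu : uniformly_tight (range nu_)).
Variables (h_ : nat -> X * Y -> R) (h : X * Y -> R).
Hypotheses (cont_h_ : forall n, continuous (h_ n)).
Hypotheses (h_ge0 : forall n z, (0 <= h_ n z)%R) (h_lim_ge0 : forall z, (0 <= h z)%R).
Hypothesis cvg_h : {family compact, h_ @ \oo --> h}.
Variables (a_ : nat -> X -> R) (b_ : nat -> Y -> R).
Hypotheses (a_ge0 : forall n x, (0 <= a_ n x)%R) (b_ge0 : forall n y, (0 <= b_ n y)%R).
Hypotheses (borel_a : forall n, measurable_fun [set: borel X] (a_ n)).
Hypotheses (borel_b : forall n, measurable_fun [set: borel Y] (b_ n)).
Hypothesis h_le : forall n x y, (h_ n (x, y) <= a_ n x + b_ n y)%R.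

Definition tail n (r : R) : \bar R :=
  \int[mu_ n]_(x in [set x | (r <= a_ n x)%R]) (a_ n x)%:E +
  \int[nu_ n]_(y in [set y | (r <= b_ n y)%R]) (b_ n y)%:E.

Let mh_ n : measurable_fun [set: borel (X * Y)%type] (h_ n).
Proof. exact: continuous_borel_real. Qed.

(** Singletons are compact, so [h] is a pointwise limit of continuous functions. *)
Let mh : measurable_fun [set: borel (X * Y)%type] h.
Proof.
apply: (@measurable_fun_cvg _ (borel (X * Y)%type) R setT h_ h mh_) => z _.
apply/cvgrPdist_lt => e e0.
have := near_uniform_compact cvg_h (@compact_set1 (X * Y)%type z) e0.
by apply: filterS => n /(_ z erefl); rewrite distrC.
Qed.

(** Pointwise, the excess of a + b over 2 r is at most a 1_{a >= r} + b 1_{b >= r}: a summand below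
    r is absorbed by one of the two r. Each term on the right depends on one variable, so any
    coupling integrates it to its marginal value. *)
Lemma integral_excess_le n sigma (r : R) : (0 <= r)%R -> couplings (mu_ n) (nu_ n) sigma ->
  \int[sigma]_z (Num.max (h_ n z - 2 * r) 0)%:E <= tail n r.
Proof.
move=> r0 cs; rewrite /tail.
have mA : measurable ([set x | (r <= a_ n x)%R] : set (borel X)).
  exact: measurable_superlevel.
have mB : measurable ([set y | (r <= b_ n y)%R] : set (borel Y)).
  exact: measurable_superlevel.
pose A (x : borel X) := (a_ n x * \1_[set x | (r <= a_ n x)%R] x)%R.
pose B (y : borel Y) := (b_ n y * \1_[set y | (r <= b_ n y)%R] y)%R.
have mfA : measurable_fun [set: borel X] A by apply: measurable_funM => //; exact: measurable_indic.
have mfB : measurable_fun [set: borel Y] B by apply: measurable_funM => //; exact: measurable_indic.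
have A0 x : (0 <= A x)%R by rewrite mulr_ge0.
have B0 y : (0 <= B y)%R by rewrite mulr_ge0.
have -> : \int[mu_ n]_(x in [set x | (r <= a_ n x)%R]) (a_ n x)%:E = \int[sigma]_z (A z.1)%:E.
  rewrite (integral_coupling_fst cs (f := EFin \o A))//.
    by rewrite integral_mkcond; apply: eq_integral => x _; rewrite epatch_indic /= EFinM.
  exact/measurable_EFinP.
have -> : \int[nu_ n]_(y in [set y | (r <= b_ n y)%R]) (b_ n y)%:E = \int[sigma]_z (B z.2)%:E.
  rewrite (integral_coupling_snd cs (f := EFin \o B))//.
    by rewrite integral_mkcond; apply: eq_integral => x _; rewrite epatch_indic /= EFinM.
  exact/measurable_EFinP.
have mA1 : measurable_fun [set: borel (X * Y)%type] (fun z => (A z.1)%:E).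
  by apply/measurable_EFinP; exact: (measurableT_comp mfA (@borel_fst X Y)).
have mB2 : measurable_fun [set: borel (X * Y)%type] (fun z => (B z.2)%:E).
  by apply/measurable_EFinP; exact: (measurableT_comp mfB (@borel_snd X Y)).
rewrite -ge0_integralD//; [|by move=> z _; rewrite lee_fin|by move=> z _; rewrite lee_fin].
apply: ge0_le_integral => //.
- by move=> z _; rewrite lee_fin le_max lexx orbT.
- by apply/measurable_EFinP; apply: measurable_maxr => //; exact: measurable_funB.
- exact: emeasurable_funD.
- move=> [x y] _; rewrite -EFinD lee_fin ge_max addr_ge0// andbT /A /B !indicE /=.
  have := h_le n x y; have := a_ge0 n x; have := b_ge0 n y.
  have -> : (x \in [set x | (r <= a_ n x)%R]) = (r <= a_ n x)%R by apply/idP/idP; rewrite inE.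
  have -> : (y \in [set y | (r <= b_ n y)%R]) = (r <= b_ n y)%R by apply/idP/idP; rewrite inE.
  by case: (leP r (a_ n x)) => ha; case: (leP r (b_ n y)) => hb /=;
    rewrite ?mulr1 ?mulr0; lra.
Qed.

Let dist_truncation (K : set (X * Y)) (theta : R -> R) :
  (forall s t, (`|theta s - theta t| <= `|s - t|)%R) -> compact K ->
  forall r : R, (0 < r)%R ->
    \forall n \near \oo, forall z, K z -> (`|theta (h_ n z) - theta (h z)| < r)%R.
Proof.
move=> lip cK r r0; apply: filterS (near_uniform_compact cvg_h cK r0) => n hn z Kz.
exact: le_lt_trans (lip _ _) (hn z Kz).
Qed.

(* No bound on [h] itself is available: the truncated excess is transferred to
   the marginals of index n, where the tails dominate it. *)
Lemma integral_excess_lim_le sigma (r e : R) : (0 <= r)%R -> couplings mu nu sigma ->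
  (forall n, tail n r <= e%:E) ->
  \int[sigma]_z (Num.max (h z - 2 * r) 0)%:E <= e%:E.
Proof.
move=> r0 cs taile.
(* The excess is capped at [k] so that the bounded case applies; monotone convergence removes the
   cap at the end. *)
pose theta (k : nat) (t : R) : R := Num.min (Num.max (t - 2 * r) 0)%R k%:R.
have theta0 k t : (0 <= theta k t)%R by rewrite le_min le_max lexx orbT ler0n.
have thetak k t : (theta k t <= k%:R)%R by rewrite ge_min lexx orbT.
have thetale k t : (theta k t <= Num.max (t - 2 * r) 0)%R by rewrite ge_min lexx.
have lip k s t : (`|theta k s - theta k t| <= `|s - t|)%R.
  apply: le_trans (lip1_minr _ _ _) _; apply: le_trans (lip1_maxr _ _ _) _.
  by rewrite opprB addrA subrK.
have mtheta k (f : borel (X * Y)%type -> R) : measurable_fun [set: borel (X * Y)%type] f ->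
    measurable_fun [set: borel (X * Y)%type] (fun z => theta k (f z)).
  move=> mf; apply: measurable_minr => //; apply: measurable_maxr => //.
  exact: measurable_funB.
have ctheta k : continuous (theta k).
  exact/lip1_continuous/lip.
have trunc k : \int[sigma]_z (theta k (h z))%:E <= e%:E.
  apply/lee_addgt0Pr => d d0.
  (* The transfer bounds the integral over the new coupling by the one over the old, and the
     opposite is wanted here. Applying it to the complementary cost [k%:R - theta k] reverses the
     inequality, since both measures have mass 1. *)
  have : \forall n \near \oo, exists2 sigma', couplings (mu_ n) (nu_ n) sigma' &
      \int[sigma']_z (k%:R - theta k (h_ n z))%:E <=
      \int[sigma]_z (k%:R - theta k (h z))%:E + d%:E.
    have : \forall n \near \oo,
    (forall sigma, couplings mu nu sigma ->
      exists2 sigma', couplings (mu_ n) (nu_ n) sigma' &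
        \int[sigma']_z (k%:R - theta k (h_ n z))%:E <=
        \int[sigma]_z (k%:R - theta k (h z))%:E + d%:E) /\
    (forall sigma, couplings (mu_ n) (nu_ n) sigma ->
      exists2 sigma', couplings mu nu sigma' &
        \int[sigma']_z (k%:R - theta k (h z))%:E <=
        \int[sigma]_z (k%:R - theta k (h_ n z))%:E + d%:E).
      apply: (@bounded_stability _ _ _ hX hY regX mu_ mu nu_ nu
        radon_mu_ radon_nu_ radon_mu radon_nu
        cvg_mu cvg_nu tight_mu tight_nu (fun n z => k%:R - theta k (h_ n z))%R
        (fun z => k%:R - theta k (h z))%R k%:R) => //.
      - move=> n z; apply: cvgB; first exact: cvg_cst.
        by apply: continuous_comp; [exact: cont_h_|exact: ctheta].
      - by apply: measurable_funB => //; exact: mtheta.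
      - by move=> n z; rewrite subr_ge0 thetak gerBl theta0.
      - by move=> z; rewrite subr_ge0 thetak gerBl theta0.
      - move=> K cK s s0; apply: filterS (dist_truncation (lip k) cK s0) => n hn z Kz.
        have -> : (k%:R - theta k (h_ n z) - (k%:R - theta k (h z)) =
          - (theta k (h_ n z) - theta k (h z)))%R by ring.
        by rewrite normrN; exact: hn.
    by apply: filterS => n [+ _]; exact.
  case=> N _ /(_ N (leqnn N)) /= [sigma' cs'].
  rewrite !ge0_integral_sub_cst//; last 4 first.
  - exact: mtheta.
  - by move=> z; rewrite theta0 thetak.
  - exact: mtheta.
  - by move=> z; rewrite theta0 thetak.
  have : \int[sigma']_z (theta k (h_ N z))%:E <= e%:E.
    apply: le_trans (taile N); apply: le_trans (integral_excess_le r0 cs').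
    apply: ge0_le_integral => //.
    - by move=> z _; rewrite lee_fin.
    - by apply/measurable_EFinP; exact: mtheta.
    - apply/measurable_EFinP; apply: measurable_maxr => //; exact: measurable_funB.
    - by move=> z _; rewrite lee_fin.
  have I0 : 0 <= \int[sigma']_z (theta k (h_ N z))%:E.
    by apply: integral_ge0 => z _; rewrite lee_fin.
  have J0 : 0 <= \int[sigma]_z (theta k (h z))%:E.
    by apply: integral_ge0 => z _; rewrite lee_fin.
  move: I0 J0; case: (integral sigma _ _) => [b| |]//; case: (integral sigma' _ _) => [c| |]//.
  by move=> _ _; rewrite -!EFinB -!EFinD !lee_fin; lra.
have mono : \int[sigma]_z (theta k (h z))%:E @[k --> \oo] -->
    \int[sigma]_z (Num.max (h z - 2 * r) 0)%:E.
  rewrite (_ : \int[sigma]_z (Num.max (h z - 2 * r) 0)%:E =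
      \int[sigma]_z limn (fun k => (theta k (h z))%:E)).
    apply: cvg_monotone_convergence => //.
    - by move=> k; apply/measurable_EFinP; exact: mtheta.
    - by move=> k z _; rewrite lee_fin.
    - by move=> z _ k l kl; rewrite lee_fin le_min2// ler_nat.
  apply: eq_integral => z _; apply/esym/cvg_lim => //; apply: cvg_near_cst.
  near=> k; congr EFin; apply/min_idPl; near: k.
  exact: nbhs_infty_ger.
rewrite -(cvg_lim _ mono)//; apply: lime_le; first by apply/cvg_ex; eexists; exact: mono.
by near=> k; exact: trunc.
Unshelve. all: by end_near.
Qed.

Lemma transport_cost_cvg :
  (forall e : R, (0 < e)%R -> exists2 r : R, (0 <= r)%R & forall n, tail n r <= e%:E) ->
  transport_cost (h_ n) (mu_ n) (nu_ n) @[n --> \oo] --> transport_cost h mu nu.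
Proof.
move=> tail_small; apply: cvge_two_sided.
  apply/ereal_infP => _ [sigma _ <-].
  by apply: integral_ge0 => z _; rewrite lee_fin.
move=> e e0; have e20 : (0 < e / 2)%R by rewrite divr_gt0.
have [r r0 tailr] := tail_small _ e20.
have eE : e%:E = (e / 2)%:E + (e / 2)%:E by rewrite -EFinD -splitr.
have r20 : (0 <= 2 * r)%R by rewrite mulr_ge0.
pose theta (t : R) : R := Num.min t (2 * r)%R.
have thetale t : (theta t <= t)%R by rewrite ge_min lexx.
have lip s t : (`|theta s - theta t| <= `|s - t|)%R by exact: lip1_minr.
have theta0r t : (0 <= t)%R -> (0 <= theta t <= 2 * r)%R.
  by move=> t0; rewrite le_min t0 r20 ge_min lexx orbT.
have mtheta (f : borel (X * Y)%type -> R) : measurable_fun [set: borel (X * Y)%type] f ->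
    measurable_fun [set: borel (X * Y)%type] (fun z => theta (f z)).
  by move=> mf; exact: measurable_minr.
have theta_le_int (m : probability (borel (X * Y)%type) R) (f : borel (X * Y)%type -> R) :
    measurable_fun [set: borel (X * Y)%type] f -> (forall z, (0 <= f z)%R) ->
    \int[m]_z (theta (f z))%:E <= \int[m]_z (f z)%:E.
  move=> mf f0; apply: ge0_le_integral => //.
  - by move=> z _; rewrite lee_fin; have /andP[] := theta0r _ (f0 z).
  - by apply/measurable_EFinP; exact: mtheta.
  - exact/measurable_EFinP.
  - by move=> z _; rewrite lee_fin.
have : \forall n \near \oo,
    (forall sigma, couplings mu nu sigma ->
      exists2 sigma', couplings (mu_ n) (nu_ n) sigma' &
        \int[sigma']_z (theta (h_ n z))%:E <= \int[sigma]_z (theta (h z))%:E + (e / 2)%:E) /\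
    (forall sigma, couplings (mu_ n) (nu_ n) sigma ->
      exists2 sigma', couplings mu nu sigma' &
        \int[sigma']_z (theta (h z))%:E <= \int[sigma]_z (theta (h_ n z))%:E + (e / 2)%:E).
  apply: (@bounded_stability _ _ _ hX hY regX mu_ mu nu_ nu
        radon_mu_ radon_nu_ radon_mu radon_nu
    cvg_mu cvg_nu tight_mu tight_nu (fun n z => theta (h_ n z)) (fun z => theta (h z))
    (2 * r)%R) => //.
  - by move=> n z; apply: continuous_comp; [exact: cont_h_|exact/lip1_continuous/lip].
  - exact: mtheta.
  - by move=> n z; exact: theta0r.
  - by move=> z; exact: theta0r.
  - by move=> K cK s s0; exact: dist_truncation.
(* Each inequality is shown against every competitor [sigma] before the infimum is taken. Half of
   [e] pays for transferring the truncated cost, half for the excess over [2 * r] under the new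
   coupling. *)
apply: filterS => n [to_n from_n]; split; rewrite -leeBlDr//; apply/ereal_infP.
- move=> _ [sigma cs <-]; rewrite leeBlDr//.
  have [sigma' cs' le] := to_n sigma cs.
  apply: (@le_trans _ _ (\int[sigma']_z (h_ n z)%:E)).
    by apply: ereal_inf_lbound; exists sigma'.
  rewrite (integral_truncation sigma' (mh_ n) (h_ge0 n) r20) eE [leRHS]addeA.
  apply: (@leeD _ (\int[sigma']_z (theta (h_ n z))%:E)).
    by apply: le_trans le _; rewrite leeD2r//; exact: theta_le_int.
  exact: le_trans (integral_excess_le r0 cs') (tailr n).
- move=> _ [sigma cs <-]; rewrite leeBlDr//.
  have [sigma' cs' le] := from_n sigma cs.
  apply: (@le_trans _ _ (\int[sigma']_z (h z)%:E)).
    by apply: ereal_inf_lbound; exists sigma'.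
  rewrite (integral_truncation sigma' mh h_lim_ge0 r20) eE [leRHS]addeA.
  apply: (@leeD _ (\int[sigma']_z (theta (h z))%:E)).
    by apply: le_trans le _; rewrite leeD2r//; exact: theta_le_int.
  exact: integral_excess_lim_le.
Qed.

End stability.

(** * From the two integrability conditions to uniformly small tails *)

Theorem theorem3p4 (R : realType) (X Y : ptopologicalType)
    (crX : completely_regular_hausdorff X)
    (crY : completely_regular_hausdorff Y)
    (mu_ : nat -> probability (borel X) R) (mu : probability (borel X) R)
    (nu_ : nat -> probability (borel Y) R) (nu : probability (borel Y) R)
    (radon_mu_ : forall n, radon_probability (mu_ n))
    (radon_mu : radon_probability mu)
    (radon_nu_ : forall n, radon_probability (nu_ n))
    (radon_nu : radon_probability nu)
    (cvg_mu : weakly_converges mu_ mu) (cvg_nu : weakly_converges nu_ nu)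
    (h_ : nat -> X * Y -> R) (h : X * Y -> R)
    (cont_h_ : forall n, continuous (h_ n))
    (h_ge0 : forall n z, (0 <= h_ n z)%R) (h_lim_ge0 : forall z, (0 <= h z)%R)
    (cvg_h : {family compact, h_ @ \oo --> h})
    (a_ : nat -> X -> R) (b_ : nat -> Y -> R)
    (a_ge0 : forall n x, (0 <= a_ n x)%R) (b_ge0 : forall n y, (0 <= b_ n y)%R)
    (borel_a : forall n, measurable_fun [set: borel X] (a_ n))
    (borel_b : forall n, measurable_fun [set: borel Y] (b_ n))
    (L1_a : forall n, (mu_ n).-integrable [set: borel X] (EFin \o a_ n))
    (L1_b : forall n, (nu_ n).-integrable [set: borel Y] (EFin \o b_ n))
    (h_le : forall n x y, (h_ n (x, y) <= a_ n x + b_ n y)%R) :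
  [/\ sequentially_prohorov R X -> sequentially_prohorov R Y ->
        uniformly_tight (range mu_) /\ uniformly_tight (range nu_),
      uniformly_tight (range mu_) -> uniformly_tight (range nu_) ->
        ereal_sup (range (fun n : nat =>
          \int[mu_ n]_(x in [set x | (r <= a_ n x)%R]) (a_ n x)%:E +
          \int[nu_ n]_(y in [set y | (r <= b_ n y)%R]) (b_ n y)%:E))
          @[r --> +oo%R] --> 0 ->
        transport_cost (h_ n) (mu_ n) (nu_ n) @[n --> \oo]
          --> transport_cost h mu nu
    & uniformly_tight (range mu_) -> uniformly_tight (range nu_) ->
        forall p : R, (1 < p)%R ->
        ereal_sup (range (fun n : nat =>
          'N[mu_ n]_p%:E[EFin \o a_ n] + 'N[nu_ n]_p%:E[EFin \o b_ n])) < +oo ->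
        transport_cost (h_ n) (mu_ n) (nu_ n) @[n --> \oo]
          --> transport_cost h mu nu].
Proof.
have [hX crsX] := crX; have [hY _] := crY.
have regX : regular_space X by exact: completely_regular_regular crsX.
have stab tmu tnu := @transport_cost_cvg R X Y hX hY regX mu_ mu nu_ nu radon_mu_ radon_nu_
  radon_mu radon_nu cvg_mu cvg_nu tmu tnu h_ h cont_h_ h_ge0 h_lim_ge0 cvg_h a_ b_
  a_ge0 b_ge0 borel_a borel_b h_le.
split.
- move=> [_ prohX] [_ prohY]; split.
    exact: prohX radon_mu_ radon_mu cvg_mu.
  exact: prohY radon_nu_ radon_nu cvg_nu.
- move=> tmu tnu tail0; apply: stab => // e e0.
  have : \forall r \near +oo%R, (0 <= r)%R /\ ereal_sup (range (tail mu_ nu_ a_ b_ ^~ r)) < e%:E.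
    near=> r; split; near: r; first exact: nbhs_pinfty_ge.
    apply: (tail0 [set y | y < e%:E]).
    by apply: open_nbhs_nbhs; split; [exact: open_ereal_lt_ereal|rewrite /= lte_fin].
  move=> /filter_ex[r [r0 supr]]; exists r => // n.
  apply: le_trans (ltW supr); apply: ereal_sup_ubound.
  by exists n.
- move=> tmu tnu p p1 supN; apply: stab => // e e0.
  set S := ereal_sup _ in supN.
  have leS n : 'N[mu_ n]_p%:E[EFin \o a_ n] + 'N[nu_ n]_p%:E[EFin \o b_ n] <= S.
    by apply: ereal_sup_ubound; exists n.
  have S0 : 0 <= S by apply: le_trans (leS 0%N); rewrite adde_ge0 ?Lnorm_ge0.
  have SE : S = (fine S)%:E by rewrite fineK// ge0_fin_numE.
  (* Each of the two tails is at most [r]^ (1 - p)[times]fine S [^ p], and [r] is chosen to make the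
     first factor [e / B]; their sum is then at most [e]. The added 1 keeps [B] positive when [S] is
     0. *)
  pose B := (2 * fine S `^ p + 1)%R.
  have B0 : (0 < B)%R by rewrite ltr_wpDl// mulr_ge0 ?powR_ge0.
  pose r := ((B / e) `^ (p - 1)^-1)%R.
  have r0 : (0 < r)%R by rewrite powR_gt0// divr_gt0.
  have rp : (r `^ (1 - p) = e / B)%R.
    rewrite -opprB powRN -powRrM mulVf ?powRr1 ?invf_div// ?subr_eq0 ?gt_eqF//.
    by rewrite ltW// divr_gt0.
  exists r => [|n]; first exact: ltW.
  apply: (@le_trans _ _ ((e / B * fine S `^ p)%:E + (e / B * fine S `^ p)%:E)).
    rewrite -rp; apply: leeD; apply: integral_superlevel_Lnorm => //.
    - by rewrite -SE (le_trans _ (leS n))// leeDl ?Lnorm_ge0.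
    - by rewrite -SE (le_trans _ (leS n))// leeDr ?Lnorm_ge0.
  rewrite -EFinD lee_fin -mulrDr mulrAC ler_pdivrMr//.
  by rewrite ler_wpM2l ?(ltW e0)// /B; lra.
Unshelve. all: by end_near.
Qed.
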